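(* Let $q\in(0,1)$, let $a,c\in\mathbb{R}$ with $ac\neq 0$, let $T>0$ and let $x_0\in\mathbb{R}^3$. Then the initial value problem $$\begin{cases} D_t^q x^1(t) = -x^2(t)x^3(t)+a\,x^1(t),\\ D_t^q x^2(t) = x^1(t)x^3(t),\\ D_t^q x^3(t) = \tfrac13 x^1(t)x^2(t)-c\,x^3(t),\end{cases}\qquad x(0)=x_0,$$ for $x=(x^1,x^2,x^3)^T$ on $[0,T]$ has a unique solution.
   Context: Superscripts on $x$ are coordinate indices, not powers. $D_t^q$ is the Caputo fractional derivative of order $q\in(0,1)$, $D_t^q f(t)=\frac{1}{\Gamma(1-q)}\int_0^t (t-s)^{-q}f'(s)\,ds$. Writing the system as $D_t^q x=f(x)$, a solution of the initial value problem on $[0,T]$ is understood in the usual sense: a continuous function $x:[0,T]\to\mathbb{R}^3$ satisfying the equivalent Volterra equation $x(t)=x_0+\frac{1}{\Gamma(q)}\int_0^t (t-s)^{q-1}f(x(s))\,ds$. The system is called the special fractional-order Chen-Lee system. *)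

(* Defs.v *)
From HB Require Import structures.
From mathcomp Require Import all_boot all_order all_algebra.
From mathcomp Require Import all_classical all_reals all_analysis.

Set Implicit Arguments.
Unset Strict Implicit.
Unset Printing Implicit Defensive.

Import Order.TTheory GRing.Theory Num.Theory.
Import numFieldNormedType.Exports.

Local Open Scope classical_set_scope.
Local Open Scope ring_scope.

(* Euler's integral; it is the Gamma function for 0 < z only (elsewhere the
   integral diverges and Rintegral returns a default value). *)
Definition Gamma (R : realType) (z : R) : R :=
  \int[@lebesgue_measure R]_(s in `]0, +oo[) (s `^ (z - 1) * expR (- s)).

(* The Riemann-Liouville fractional integral of order q,
   1/Gamma(q) * int_0^t (t - s)^(q-1) g(s) ds.  For q in (0,1) the kernel is
   singular but Lebesgue integrable on [0,t], so the integral is a genuine one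
   whenever g is continuous on [0,t]; the value 0 `^ (q - 1) = 0 of the kernel
   at s = t concerns a null set. *)
Definition frac_integral (R : realType) (q : R) (g : R -> R) (t : R) : R :=
  (Gamma q)^-1 *
  \int[@lebesgue_measure R]_(s in `[0, t]) ((t - s) `^ (q - 1) * g s).

(* x solves D_t^q x = f(x), x(0) = x0 on [0,T], D_t^q being the Caputo
   derivative of order q in (0,1): x is continuous on [0,T] and satisfies the
   equivalent Volterra equation there, coordinatewise (at t = 0 the equation
   reads x(0) = x0).  The values of x outside [0,T] are irrelevant. *)
Definition caputo_ivp_solution (R : realType) (n : nat) (q : R)
    (f : 'cV[R]_n -> 'cV[R]_n) (x0 : 'cV[R]_n) (T : R) (x : R -> 'cV[R]_n) :=
  {within `[0, T], continuous x} /\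
  forall t : R, 0 <= t <= T ->
    x t = x0 + \col_i frac_integral q (fun s => f (x s) i 0) t.

(* Coordinate k of 'I_3 is the coordinate x^(k+1). *)
Definition chen_lee (R : realType) (a c : R) (x : 'cV[R]_3) : 'cV[R]_3 :=
  let x1 := x (@Ordinal 3 0 isT) 0 in
  let x2 := x (@Ordinal 3 1 isT) 0 in
  let x3 := x (@Ordinal 3 2 isT) 0 in
  \col_(i < 3) [:: - (x2 * x3) + a * x1;
                   x1 * x3;
                   3^-1 * x1 * x2 - c * x3]`_i.

(* Main.v *)
Require Import Defs.
From mathcomp Require Import all_boot all_order all_algebra.
From mathcomp Require Import all_classical all_reals all_analysis.
From mathcomp Require Import measurable_realfun zify ring lra.

(** The field is quadratic, so the point is to exclude blow-up before [T].  With
    E(v) = 2 v1^2 + v2^2 + 3 v3^2 the cubic terms cancel in the product of v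
    and the field weighted by 2, 1, 3, which is therefore at most
    (|a| + |c|) E(v) ([chen_lee_energy_rate_le]).  For an ordinary differential
    equation this would bound E along solutions at once.  For the Volterra
    equation x = x0 + I g, with I the fractional integral, the chain rule is
    replaced by the inequality x^2 <= x0^2 + 2 I (x g), which amounts to
    (I g)^2 <= 2 I (g * I g) ([RL_sqr_le]).

    That inequality comes from the kernel t^(q-1) being decreasing and
    log-convex.  If a positive sequence b has these two properties then, by an
    argument of Kaluza, the reciprocal of the power series with coefficients b
    has a positive constant coefficient, all its other coefficients are
    nonpositive and its partial sums are nonnegative.  Convolution with this
    reciprocal is a discrete fractional derivative, for which the chain rule
    inequality is elementary algebra ([conv_sqr_le]).  Sampling with step h
    replaces I by such a convolution with an error O(h^q) on functions that are
    Hoelder continuous of exponent q ([sampling_error]), and h tends to 0.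

    Since K I(e^(l s)) <= e^(l t) / 2 on [0, T] when l is large
    ([exists_expR_rate]), an inequality v <= A + K I v forces
    v <= 2 A e^(l t) ([gronwall]).  With A = 0 this gives uniqueness; applied
    to E along a solution it gives a bound that depends on the field through
    |a| + |c| only ([a_priori_bound]).  So the field may be composed with
    the radial retraction onto a ball: the energy inequality survives, and the
    new field is bounded and globally Lipschitz, so that Picard iteration
    converges on the whole of [0, T] ([exists_volterra_lipschitz]).  When the
    ball is chosen larger than the a priori bound, the solution obtained never
    leaves it and solves the original equation ([exists_volterra_energy]). *)

Set Implicit Arguments.
Unset Strict Implicit.
Unset Printing Implicit Defensive.

Import Order.TTheory GRing.Theory Num.Theory.
Import numFieldNormedType.Exports.

Local Open Scope classical_set_scope.
Local Open Scope ring_scope.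

(** * Elementary estimates *)

Lemma powR_anti (R : realType) (r x y : R) : r <= 0 -> 0 < x -> x <= y ->
  y `^ r <= x `^ r.
Proof.
move=> r0 x0 xy; have y0 := lt_le_trans x0 xy.
rewrite -oppr_ge0 in r0; rewrite -[r]opprK.
move: (- r) r0 => s s0; rewrite !powRN lef_pV2 ?posrE ?powR_gt0//.
by apply: ge0_ler_powR; rewrite ?nnegrE// ltW.
Qed.

Lemma le0_div_exp2 (R : realType) (x c : R) : 0 <= c ->
  (forall n : nat, x <= c / 2 ^+ n) -> x <= 0.
Proof.
move=> c0 xc; rewrite leNgt; apply/negP => x0.
have h := archi_boundP (divr_ge0 c0 (ltW x0)).
have := xc (Num.bound (c / x)).
rewrite leNgt ltr_pdivrMr ?exprn_gt0// mulrC -ltr_pdivrMr//.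
by rewrite (lt_le_trans h)// -natrX ler_nat ltnW// ltn_expl.
Qed.

Lemma powR_le_expR (R : realType) (y r : R) : 0 < y -> 0 <= r <= 1 ->
  y `^ r <= expR y.
Proof.
move=> y0 /andP[r0 r1]; rewrite /powR gt_eqF// ler_expR.
have lny : ln y <= y.
  have := @le_ln1Dx R (y - 1); rewrite ltrBrDl subrr y0 addrCA subrr addr0.
  by move=> /(_ isT) /le_trans; apply; rewrite gerBl.
have [ln0|ln0] := leP 0 (ln y).
  by rewrite (le_trans _ lny)// ler_piMl.
by apply: (@le_trans _ _ 0); [apply: mulr_ge0_le0 => //; exact: ltW|exact: ltW].
Qed.

Lemma le0_vanishing_powR (R : realType) (q x c t : R) : 0 < q -> 0 <= c -> 0 <= t ->
  (forall n : nat, x <= c * (t / n.+1%:R) `^ q) -> x <= 0.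
Proof.
move=> q0 c0 t0 xc; rewrite leNgt; apply/negP => x0.
pose y := c * t `^ q / x.
have y0 : 0 <= y by rewrite divr_ge0 ?(ltW x0)// mulr_ge0// powR_ge0.
pose n := Num.bound (y `^ q^-1).
have yn : y < n.+1%:R `^ q.
  have {1}-> : y = (y `^ q^-1) `^ q by rewrite -powRrM mulVf ?gt_eqF// powRr1.
  apply: gt0_ltr_powR; rewrite ?nnegrE ?powR_ge0//.
  apply: (lt_le_trans (archi_boundP (powR_ge0 _ _))).
  by rewrite ler_nat -/n.
have := xc n; rewrite leNgt => /negP; apply.
rewrite powRM// ?invr_ge0// mulrA -powR_inv1// -powRrM mulN1r powRN.
rewrite ltr_pdivrMr ?powR_gt0//. by rewrite [ltRHS]mulrC -ltr_pdivrMr.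
Qed.

Lemma continuous_of_holder (R : realType) (V : normedModType R) (q : R)
    (f : R -> V) : 0 < q ->
  (forall t, exists2 D, 0 <= D &
     forall s, `|t - s| < 1 -> `|f t - f s| <= D * `|t - s| `^ q) ->
  continuous f.
Proof.
move=> q0 fC t; have [D D0 fD] := fC t.
apply/cvgrPdist_lt => e e0.
pose d := (e / (D + 1)) `^ q^-1.
have D1 : 0 < D + 1 by rewrite ltr_wpDl.
have ed0 : 0 < e / (D + 1) by rewrite divr_gt0.
have d0 : 0 < d by rewrite powR_gt0.
near=> s.
have sd : `|t - s| < d by near: s; exact: cvgr_dist_lt.
have s1 : `|t - s| < 1 by near: s; exact: cvgr_dist_lt.
apply: (le_lt_trans (fD _ s1)).
have h : `|t - s| `^ q < e / (D + 1).
  have -> : e / (D + 1) = d `^ q by rewrite -powRrM mulVf ?gt_eqF// powRr1// ltW.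
  by apply: gt0_ltr_powR; rewrite ?nnegrE// ltW.
apply: (@le_lt_trans _ _ (D * (e / (D + 1)))); first by rewrite ler_wpM2l// ltW.
by rewrite mulrA ltr_pdivrMr// mulrC ltr_pM2l// ltrDl.
Unshelve. all: by end_near. Qed.

(** The intervals of radius 2 C / 2^n around u n are nested. *)
Lemma sequence_geometric_limit (R : realType) (u : nat -> R) (C : R) :
  (forall n, `|u n.+1 - u n| <= C / 2 ^+ n) ->
  exists l, forall n, `|l - u n| <= 2 * C / 2 ^+ n.
Proof.
move=> uC.
have C0 : 0 <= C by have := le_trans (normr_ge0 _) (uC 0); rewrite expr0 divr1.
pose e n : R := 2 * C / 2 ^+ n.
have eS n : e n - e n.+1 = C / 2 ^+ n.
  by rewrite /e exprS; field; rewrite expf_neq0.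
have e0 n : 0 <= e n by rewrite divr_ge0 ?mulr_ge0 ?exprn_ge0.
have lo n m : u n - e n <= u (n + m)%N - e (n + m)%N.
  elim: m => [|m IH]; first by rewrite addn0.
  apply: (le_trans IH); rewrite addnS.
  have := uC (n + m)%N; rewrite -eS ler_norml => /andP[+ _].
  by move: (u _) (u _) (e _) (e _); clear => *; lra.
have hi n m : u (n + m)%N + e (n + m)%N <= u n + e n.
  elim: m => [|m IH]; first by rewrite addn0.
  apply: le_trans IH; rewrite addnS.
  have := uC (n + m)%N; rewrite -eS ler_norml => /andP[_].
  by move: (u _) (u _) (e _) (e _); clear => *; lra.
have lohi n m : u n - e n <= u m + e m.
  apply: (le_trans (lo n m)); apply: (@le_trans _ _ (u (n + m)%N + e (n + m)%N)).
    by rewrite lerD2l (@le_trans _ _ 0)// oppr_le0.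
  by rewrite addnC hi.
pose A := range (fun n => u n - e n).
have A0 : A !=set0 by exists (u 0%N - e 0%N); exists 0%N.
have ubA m : ubound A (u m + e m) by move=> _ [n _ <-]; exact: lohi.
exists (sup A) => n; rewrite -/(e n) ler_distl; apply/andP; split.
  by apply: ub_le_sup; [exists (u n + e n); exact: ubA|exists n].
exact: ge_sup (ubA n).
Qed.

Lemma continuous_norm_of (R : realType) (V : normedModType R) (f : R -> V) :
  continuous f -> continuous (fun s => `|f s|).
Proof.
move=> cf s; apply: (@continuous_comp _ _ _ f (fun v : V => `|v|)).
  exact: cf.
exact: norm_continuous.
Qed.

Lemma continuous_dist (R : realType) (V : normedModType R) (f g : R -> V) :
  continuous f -> continuous g -> continuous (fun s => `|f s - g s|).
Proof.
move=> cf cg; apply: (@continuous_norm_of _ _ (fun s => f s - g s)) => s.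
by apply: cvgB; [exact: cf|exact: cg].
Qed.

Lemma continuous_sum (R : realType) (I : Type) (r : seq I) (g : I -> R -> R) :
  (forall i, continuous (g i)) -> continuous (fun s => \sum_(i <- r) g i s).
Proof.
move=> cg; elim: r => [|i r IH].
  by under eq_fun do rewrite big_nil; move=> ?; exact: cst_continuous.
under eq_fun do rewrite big_cons.
by move=> s; apply: cvgD; [exact: cg|exact: IH].
Qed.

Lemma continuous_bounded_itv (R : realType) (g : R -> R) (a b : R) : continuous g ->
  exists2 M, 0 <= M & forall s, a <= s <= b -> `|g s| <= M.
Proof.
move=> cg; have [ab|ba] := leP a b; last first.
  by exists 0 => // s /andP[as_ /(le_trans as_)]; rewrite leNgt ba.
have [//|c _ cM] := @EVT_max R (fun x => `|g x|) a b ab.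
  apply: continuous_subspaceT => x.
  by apply: continuous_comp; [exact: cg|exact: norm_continuous].
by exists `|g c| => // s sab; apply: cM; rewrite in_itv.
Qed.

(** * The weakly singular kernel *)

Lemma is_derive_powR_sub (R : realType) (p t s : R) : p != 0 -> s < t ->
  is_derive s 1 (fun s => - ((t - s) `^ p / p)) ((t - s) `^ (p - 1)).
Proof.
move=> p0 st.
have ts : t - s \in `]0, +oo[ by rewrite in_itv/= andbT subr_gt0.
have dp : is_derive (t - s) 1 (fun x : R => x `^ p) (p * (t - s) `^ (p - 1)).
  rewrite -(powR_derive1 _ ts) derive1E; apply/derivableP.
  exact: derivable_powR.
have ds : is_derive s 1 (fun s : R => t - s) (- 1).
  by apply: is_derive_eq; rewrite add0r mul1r.
have d := @is_derive1_comp R (fun x => x `^ p) (fun s => t - s) s _ _ dp ds.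
have -> : (fun s0 : R => - ((t - s0) `^ p / p)) =
    (fun s0 => (- p^-1) *: ((t - s0) `^ p)).
  by apply/funext => z; rewrite scaleNr /GRing.scale/= mulrC.
by apply: is_derive_eq; rewrite /GRing.scale/=; field.
Qed.

Lemma continuous_kernel (R : realType) (p t s : R) : s < t ->
  {for s, continuous (fun s : R => (t - s) `^ p)}.
Proof.
move=> st.
have [->|p0] := eqVneq p 0.
  rewrite (_ : (fun _ => _) = cst 1); first exact: cst_continuous.
  by apply/funext => z; rewrite powRr0.
have := is_derive_powR_sub p0 st => -[d _].
apply: differentiable_continuous; apply/derivable1_diffP.
rewrite (_ : (fun s : R => (t - s) `^ p) =
    (fun s => (- p) *: (- ((t - s) `^ p / p)))).
  exact: derivableZ.
by apply/funext => z; rewrite /GRing.scale/=; field.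
Qed.

Lemma integral_kernel_lt (R : realType) (p a b t : R) : 0 < p -> a < b -> b < t ->
  (\int[@lebesgue_measure R]_(s in `[a, b]) ((t - s) `^ (p - 1))%:E
   = (((t - a) `^ p - (t - b) `^ p) / p)%:E)%E.
Proof.
move=> p0 ab bt.
have pn0 : p != 0 by rewrite gt_eqF.
have dF s : s <= b ->
    is_derive s 1 (fun s => - ((t - s) `^ p / p)) ((t - s) `^ (p - 1)).
  by move=> sb; apply: is_derive_powR_sub => //; apply: le_lt_trans bt.
have cF s : s <= b -> {for s, continuous (fun s => - ((t - s) `^ p / p))}.
  move=> sb; apply: differentiable_continuous; apply/derivable1_diffP.
  by have [] := dF _ sb.
rewrite (@continuous_FTC2 _ _ (fun s => - ((t - s) `^ p / p))) //.
- by rewrite -EFinB; congr EFin; field.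
- apply: continuous_in_subspaceT => s /[!inE]/= /[!in_itv]/= /andP[_ sb].
  by apply: continuous_kernel; exact: le_lt_trans bt.
- split.
  + by move=> s /[!in_itv]/= /andP[_ /ltW sb]; have [] := dF _ sb.
  + apply: cvg_at_right_filter; apply: cF; exact: ltW.
  + by apply: cvg_at_left_filter; apply: cF.
- move=> s /[!in_itv]/= /andP[_ /ltW sb]; rewrite derive1E.
  by have [] := dF _ sb.
Qed.

Lemma measurable_kernel (R : realType) (p t : R) :
  measurable_fun [set: R] (fun s : R => (t - s) `^ p).
Proof.
apply: (measurableT_comp (measurable_powR p)).
exact: measurable_funB.
Qed.

Lemma integral_kernel (R : realType) (p a b t : R) : 0 < p -> a <= b -> b <= t ->
  (\int[@lebesgue_measure R]_(s in `[a, b[) ((t - s) `^ (p - 1))%:E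
   = (((t - a) `^ p - (t - b) `^ p) / p)%:E)%E.
Proof.
move=> p0; rewrite le_eqVlt => /predU1P[->|ab].
  by rewrite set_itvco0 integral_set0 subrr mul0r.
have mk (D : set R) : measurable D ->
    measurable_fun D (EFin \o (fun s : R => (t - s) `^ (p - 1))).
  move=> mD; apply/measurable_EFinP; apply: measurable_funTS.
  exact: measurable_kernel.
rewrite le_eqVlt => /predU1P[bt|bt]; last first.
  rewrite integral_itv_bndo_bndc; last exact: mk.
  exact: integral_kernel_lt.
subst b.
(* The kernel blows up at t when p < 1, so the fundamental theorem of calculus
   is applied on [a, c n] with c n increasing to t. *)
pose c (n : nat) : R := t - (t - a) / n.+2%:R.
have ta : 0 < t - a by rewrite subr_gt0.
have ac n : a < c n.
  by rewrite /c ltrBrDr -ltrBrDl ltr_pdivrMr ?ltr0n// ltr_pMr// ltr1n.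
have ct n : c n < t by rewrite /c gtrBl divr_gt0.
have -> : `[a, t[%classic = \bigcup_n `[a, c n]%classic.
  apply/seteqP; split => s /=.
    rewrite in_itv/= => /andP[as_ st].
    have ts : 0 < t - s by rewrite subr_gt0.
    exists (Num.bound ((t - a) / (t - s))) => //=.
    rewrite in_itv/= as_/= /c lerBrDl -lerBrDr ler_pdivrMr ?ltr0n//.
    rewrite mulrC -ler_pdivrMr//.
    apply/ltW/(lt_le_trans (archi_boundP _)); first by rewrite divr_ge0 ?ltW.
    by rewrite ler_nat leqW.
  move=> [n _] /=; rewrite !in_itv/= => /andP[-> sc]/=.
  exact: le_lt_trans sc (ct n).
have cv : ((((t - a) `^ p - (t - c n) `^ p) / p)%:E @[n --> \oo] -->
    (((t - a) `^ p - (t - t) `^ p) / p)%:E)%E.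
  apply: cvg_EFin; first exact: nearW.
  apply: cvgM; last exact: cvg_cst.
  apply: cvgB; first exact: cvg_cst.
  rewrite subrr powR0 ?gt_eqF//.
  have -> : (fun n => (t - c n) `^ p) = (fun n => ((t - a) / n.+2%:R) `^ p).
    by apply/funext => n; rewrite /c opprB addrCA subrr addr0.
  apply: ((cvg_at_rightP (fun x => x `^ p) 0 0).1 (powR_cvg0 p0)).
  split=> [n|]; first by rewrite divr_gt0.
  rewrite -[X in _ --> X](mulr0 (t - a)); apply: cvgM; first exact: cvg_cst.
  by have := @cvg_harmonic R; rewrite -cvg_shiftS.
apply: (cvg_unique _ _ cv) => //.
have : (\int[@lebesgue_measure R]_(s in `[a, c n])
      ((t - s) `^ (p - 1))%:E @[n --> \oo] -->
    \int[@lebesgue_measure R]_(s in \bigcup_n `[a, c n]%classic)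
      ((t - s) `^ (p - 1))%:E)%E.
  apply: ge0_nondecreasing_set_cvg_integral.
  - apply/nondecreasing_seqP => n; apply/subsetPset; apply: subset_itvl.
    rewrite bnd_simp /c lerD2l lerN2 ler_pM2l// lef_pV2 ?posrE ?ltr0n//.
    by rewrite ler_nat.
  - by [].
  - by move=> n; apply: mk.
  - by move=> n x _; rewrite lee_fin powR_ge0.
by under eq_cvg do rewrite integral_kernel_lt//.
Qed.

(** The upper limit of integration is split from the t of the kernel, so that the
    integral over [0, t[ can be cut into pieces; the half-open interval keeps the
    kernel away from its singularity, where powR takes the value 0. *)
Definition kint (R : realType) (p t a b : R) (g : R -> R) : R :=
  \int[@lebesgue_measure R]_(s in `[a, b[) ((t - s) `^ (p - 1) * g s).

Section kint.
Variables (R : realType) (p : R).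
Hypothesis p0 : 0 < p.
Implicit Types (a b t M : R) (g : R -> R).

Lemma integrable_kernel a b t : a <= b -> b <= t ->
  (@lebesgue_measure R).-integrable `[a, b[
    (EFin \o (fun s => (t - s) `^ (p - 1))).
Proof.
move=> ab bt; apply/integrableP; split.
  apply/measurable_EFinP; apply: measurable_funTS; exact: measurable_kernel.
under eq_integral do rewrite /= ger0_norm ?powR_ge0//.
by rewrite integral_kernel// ltry.
Qed.

Lemma integrable_kernelM a b t g : a <= b -> b <= t -> continuous g ->
  (@lebesgue_measure R).-integrable `[a, b[
    (EFin \o (fun s => (t - s) `^ (p - 1) * g s)).
Proof.
move=> ab bt cg.
rewrite (_ : EFin \o (fun s : R => ((t - s) `^ (p - 1) * g s)) =
    ((EFin \o (fun s : R => ((t - s) `^ (p - 1))%R)) \* (EFin \o g))%E); last first.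
  by apply/funext => s; rewrite /= EFinM.
apply: integrableMl => //.
- exact: integrable_kernel.
- by apply: measurable_funTS; exact: continuous_measurable_fun.
- have [M _ gM] := continuous_bounded_itv a b cg.
  exists M; split; first exact: num_real.
  move=> N MN s /=; rewrite in_itv/= => /andP[as_ sb].
  by rewrite (le_trans (gM _ _) (ltW MN))// as_ ltW.
Qed.

Lemma kint_cst a b t c : a <= b -> b <= t ->
  kint p t a b (fun=> c) = ((t - a) `^ p - (t - b) `^ p) / p * c.
Proof.
move=> ab bt; rewrite /kint RintegralZr//; last exact: integrable_kernel.
by rewrite /Rintegral integral_kernel.
Qed.

Lemma kint_le a b t g h : a <= b -> b <= t -> continuous g -> continuous h ->
  (forall s, a <= s < b -> g s <= h s) -> kint p t a b g <= kint p t a b h.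
Proof.
move=> ab bt cg ch gh; apply: le_Rintegral => //.
- exact: integrable_kernelM.
- exact: integrable_kernelM.
- by move=> s /=; rewrite in_itv/= => sab; rewrite ler_wpM2l ?powR_ge0 ?gh.
Qed.

Lemma kintD a b t g h : a <= b -> b <= t -> continuous g -> continuous h ->
  kint p t a b (fun s => g s + h s) = kint p t a b g + kint p t a b h.
Proof.
move=> ab bt cg ch; rewrite /kint.
under eq_Rintegral do rewrite mulrDr.
by rewrite RintegralD//; exact: integrable_kernelM.
Qed.

Lemma kintZ a b t g c : a <= b -> b <= t -> continuous g ->
  kint p t a b (fun s => c * g s) = c * kint p t a b g.
Proof.
move=> ab bt cg; rewrite /kint.
under eq_Rintegral do rewrite mulrCA.
by rewrite RintegralZl//; exact: integrable_kernelM.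
Qed.

Lemma kintN a b t g : a <= b -> b <= t -> continuous g ->
  kint p t a b (fun s => - g s) = - kint p t a b g.
Proof.
move=> ab bt cg; rewrite -mulN1r -kintZ//.
by apply: eq_Rintegral => s _; rewrite mulN1r.
Qed.

Lemma kint_cat a b c t g : a <= b -> b <= c -> c <= t -> continuous g ->
  kint p t a c g = kint p t a b g + kint p t b c g.
Proof.
move=> ab bc ct cg; rewrite /kint.
rewrite (@itv_bndbnd_setU _ _ _ (BLeft b)) ?bnd_simp//.
rewrite Rintegral_setU//.
  rewrite -itv_bndbnd_setU ?bnd_simp//.
  by apply: integrable_kernelM => //; exact: le_trans bc.
rewrite disj_set2E; apply/eqP/seteqP; split => // s [] /=.
by rewrite !in_itv/= => /andP[_ sb] /andP[]; rewrite leNgt sb.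
Qed.

Lemma kint_norm_le a b t g M : a <= b -> b <= t -> continuous g ->
  (forall s, a <= s < b -> `|g s| <= M) ->
  `|kint p t a b g| <= ((t - a) `^ p - (t - b) `^ p) / p * M.
Proof.
move=> ab bt cg gM.
have cc (c : R) : continuous (fun _ : R => c) by move=> ?; exact: cst_continuous.
rewrite ler_norml -mulrN -!kint_cst//; apply/andP; split; apply: kint_le => // s sab.
  by have := gM _ sab; rewrite ler_norml => /andP[].
by have := gM _ sab; rewrite ler_norml => /andP[].
Qed.

Lemma kint_anti a b t t' g : p <= 1 -> a <= b -> b <= t -> t <= t' -> continuous g ->
  (forall s, a <= s < b -> 0 <= g s) -> kint p t' a b g <= kint p t a b g.
Proof.
move=> p1 ab bt tt' cg g0.
have bt' : b <= t' by exact: le_trans tt'.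
apply: le_Rintegral => //; [exact: integrable_kernelM|exact: integrable_kernelM|].
move=> s /=; rewrite in_itv/= => /[dup] sab /andP[as_ sb].
rewrite ler_wpM2r ?g0//.
have ts : 0 < t - s by rewrite subr_gt0 (lt_le_trans sb).
by apply: powR_anti => //; rewrite ?subr_le0 ?lerD2r.
Qed.

End kint.

Lemma kint_sum (R : realType) (I : Type) (r : seq I) (p t a b : R) (g : I -> R -> R) :
  0 < p -> a <= b -> b <= t -> (forall i, continuous (g i)) ->
  kint p t a b (fun s => \sum_(i <- r) g i s) = \sum_(i <- r) kint p t a b (g i).
Proof.
move=> p0 ab bt cg.
elim: r => [|i r IH].
  under [X in kint _ _ _ _ X]eq_fun do rewrite big_nil.
  by rewrite kint_cst// mulr0 big_nil.
under [X in kint _ _ _ _ X]eq_fun do rewrite big_cons.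
by rewrite kintD// ?IH ?big_cons//; exact: continuous_sum.
Qed.

(** * The Riemann-Liouville integral *)

(** Gamma(q) times the Riemann-Liouville integral. *)
Definition RL (R : realType) (q : R) (g : R -> R) (t : R) : R := kint q t 0 t g.

Section RL.
Variables (R : realType) (q : R).
Hypotheses (q0 : 0 < q) (q1 : q <= 1).
Implicit Types (t T M : R) (g : R -> R).

Lemma RL_norm_le g t M : 0 <= t -> continuous g ->
  (forall s, 0 <= s <= t -> `|g s| <= M) -> `|RL q g t| <= t `^ q / q * M.
Proof.
move=> t0 cg gM; have := @kint_norm_le R q q0 0 t t g M t0 (lexx _) cg.
rewrite subr0 subrr powR0 ?gt_eqF// subr0; apply=> s /andP[s0 st].
by rewrite gM// s0 ltW.
Qed.

(** The kernel decreases in t, so moving from t to t' changes the integral over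
    [0, t[ by at most M times the change of the integral of the kernel itself,
    and t^q - t'^q <= 0. *)
Lemma RL_holder g t t' M : 0 <= t -> t <= t' -> continuous g ->
  (forall s, 0 <= s <= t' -> `|g s| <= M) ->
  `|RL q g t' - RL q g t| <= 2 * M / q * (t' - t) `^ q.
Proof.
move=> t0 tt' cg gM.
have M0 : 0 <= M by rewrite (le_trans _ (gM t _))// t0 tt'.
have cc (c : R) : continuous (fun _ : R => c) by move=> ?; exact: cst_continuous.
have cp : continuous (fun s => M + g s).
  by move=> x; apply: cvgD; [exact: cst_continuous|exact: cg].
have cm : continuous (fun s => M - g s).
  by move=> x; apply: cvgB; [exact: cst_continuous|exact: cg].
have cN : continuous (fun s => - g s).
  by move=> x; apply: cvgN; exact: cg.
rewrite /RL (kint_cat q0 t0 tt')//.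
have h1 : `|kint q t' t t' g| <= (t' - t) `^ q / q * M.
  have := @kint_norm_le R q q0 t t' t' g M tt' (lexx _) cg.
  rewrite subrr powR0 ?gt_eqF// subr0; apply=> s /andP[ts st].
  by rewrite gM// (le_trans t0 ts) ltW.
have gm s : 0 <= s < t -> `|g s| <= M.
  by move=> /andP[s0 st]; rewrite gM// s0 ltW// (lt_le_trans st).
(* [kint_anti] is for nonnegative functions: it is applied to M + g and M - g. *)
have h2 : kint q t' 0 t (fun s => M + g s) <= kint q t 0 t (fun s => M + g s).
  apply: kint_anti => // s /gm; rewrite ler_norml => /andP[+ _].
  by rewrite lerNl -subr_ge0 opprK addrC.
have h3 : kint q t' 0 t (fun s => M - g s) <= kint q t 0 t (fun s => M - g s).
  apply: kint_anti => // s /gm; rewrite ler_norml => /andP[_].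
  by rewrite -subr_ge0.
rewrite !kintD// !kintN// !kint_cst// !subr0 subrr powR0 ?gt_eqF// in h2 h3.
rewrite !subr0 in h2 h3.
have hq : t `^ q <= t' `^ q.
  by rewrite ge0_ler_powR ?nnegrE ?(ltW q0)// (le_trans t0).
have hm : t `^ q / q * M <= t' `^ q / q * M.
  by rewrite ler_wpM2r// ler_wpM2r ?invr_ge0 ?(ltW q0).
move: h1; rewrite !ler_norml => /andP[h1a h1b].
have -> : 2 * M / q * (t' - t) `^ q = (t' - t) `^ q / q * M *+ 2.
  by rewrite mulr2n -!mulrA mulrC; ring.
move: h2 h3 hm h1a h1b; rewrite !mulrBl.
move: (t `^ q / q * M) (t' `^ q / q * M) ((t' - t) `^ q / q * M).
move: (kint q t' 0 t g) (kint q t 0 t g) (kint q t' t t' g).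
clear=> *; apply/andP; split; lra.
Qed.

Lemma RL_le0 g t : t <= 0 -> RL q g t = 0.
Proof.
by move=> t0; rewrite /RL /kint set_itv_ge ?Rintegral_set0// bnd_simp -leNgt.
Qed.

(** Negative times are allowed, where the integral is empty; this is what makes
    [RL q g] continuous on the whole line. *)
Lemma RL_holder_abs g T M : 0 <= T -> continuous g ->
  (forall s, 0 <= s <= T -> `|g s| <= M) ->
  forall t t', t <= T -> t' <= T ->
  `|RL q g t - RL q g t'| <= 2 * M / q * `|t - t'| `^ q.
Proof.
move=> T0 cg gM t t'; wlog tt' : t t' / t' <= t => [wl tT tT'|tT tT'].
  by have [|/ltW] := leP t' t => h; [|rewrite distrC [`|t - t'|]distrC]; apply: wl.
have M0 : 0 <= M by apply: le_trans (gM 0 _); rewrite ?lexx.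
have C0 : 0 <= 2 * M / q by rewrite divr_ge0 ?mulr_ge0// ltW.
have [t0|t0] := leP t 0.
  rewrite (RL_le0 _ t0) RL_le0 ?(le_trans tt')// subrr normr0.
  by rewrite mulr_ge0 ?powR_ge0.
have gM' s : 0 <= s <= t -> `|g s| <= M.
  by move=> /andP[s0 st]; rewrite gM// s0 (le_trans st).
rewrite (ger0_norm (_ : 0 <= t - t')) ?subr_ge0//.
have [t'0|t'0] := leP 0 t'; first exact: RL_holder.
rewrite (@RL_le0 _ t' (ltW t'0)) -(@RL_le0 g 0 (lexx 0)).
apply: (le_trans (RL_holder (lexx 0) (ltW t0) cg gM')).
rewrite ler_wpM2l//; apply: ge0_ler_powR;
  rewrite ?nnegrE ?subr_ge0 ?(ltW q0) ?(ltW t0)//.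
by rewrite lerD2l lerN2 ltW.
Qed.

Lemma continuous_RL g : continuous g -> continuous (RL q g).
Proof.
move=> cg; apply: (@continuous_of_holder _ _ q) => // t.
have [M M0 gM] := continuous_bounded_itv 0 (`|t| + 1) cg.
exists (2 * M / q); first by rewrite divr_ge0 ?mulr_ge0// ltW.
move=> s ts; apply: (@RL_holder_abs _ (`|t| + 1) M) => //.
- by rewrite (le_trans (ler_norm _))// lerDl.
- rewrite (le_trans (ler_norm _))// -[s](subKr t) (le_trans (ler_normB _ _))//.
  by rewrite lerD2l ltW.
Qed.

Lemma RL_dist_le (g h e : R -> R) t : 0 <= t ->
  continuous g -> continuous h -> continuous e ->
  (forall s, 0 <= s <= t -> `|g s - h s| <= e s) ->
  `|RL q g t - RL q h t| <= RL q e t.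
Proof.
move=> t0 cg ch ce ghe.
have cgh : continuous (fun s => h s + e s).
  by move=> s; apply: cvgD; [exact: ch|exact: ce].
have chg : continuous (fun s => g s + e s).
  by move=> s; apply: cvgD; [exact: cg|exact: ce].
have ghe' s : 0 <= s < t -> `|g s - h s| <= e s.
  by move=> /andP[s0 st]; rewrite ghe// s0 ltW.
rewrite ler_distlC; apply/andP; split.
  rewrite lerBlDr /RL -kintD//; apply: kint_le => // s /ghe'.
  by rewrite ler_distlC => /andP[+ _]; rewrite lerBlDr.
rewrite /RL -kintD//; apply: kint_le => // s /ghe'.
by rewrite ler_distlC => /andP[_].
Qed.

End RL.

(** * Exponential weights and Gronwall's inequality *)

Section gronwall.
Variables (R : realType) (q : R).
Hypotheses (q0 : 0 < q) (q1 : q <= 1).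
Implicit Types (t T K A : R) (v : R -> R).

Lemma continuous_expRM (l : R) : continuous (fun s => expR (l * s)).
Proof.
move=> s; apply: (@continuous_comp _ _ _ (fun s => l * s) expR).
  by apply: cvgM; [exact: cvg_cst|exact: cvg_id].
exact: continuous_expR.
Qed.

(** With y = l (t - s), the bound e^(-y) <= y^(-q/2) trades half of the
    integrability of the kernel for a factor l^(-q/2) that is small for large l. *)
Lemma RL_expR_le (l t : R) : 0 < l -> 0 <= t ->
  RL q (fun s => expR (l * s)) t <=
    expR (l * t) * (l `^ (q / 2))^-1 * (t `^ (q / 2) / (q / 2)).
Proof.
move=> l0 t0; have p0 : 0 < q / 2 by rewrite divr_gt0.
have := @kint_cst R (q / 2) p0 0 t t
  (expR (l * t) * (l `^ (q / 2))^-1) t0 (lexx t).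
rewrite subr0 subrr powR0 ?gt_eqF// subr0 [in X in _ = X]mulrC => <-.
apply: le_Rintegral => //.
- by apply: integrable_kernelM => //; exact: continuous_expRM.
- by apply: integrable_kernelM => // ?; exact: cst_continuous.
move=> s /=; rewrite in_itv/= => /andP[_ st].
have ts : 0 < t - s by rewrite subr_gt0.
have -> : q / 2 - 1 = q - 1 - q / 2 by field.
rewrite [leRHS](_ : _ = (t - s) `^ (q - 1) *
  (expR (l * t) * (l * (t - s)) `^ (- (q / 2)))); last first.
  rewrite powRM ?(ltW l0) ?(ltW ts)// (@powRD _ _ (q - 1)); last first.
    by rewrite (gt_eqF ts) implybT.
  by rewrite !powRN; ring.
rewrite ler_wpM2l ?powR_ge0//.
have -> : l * s = l * t - l * (t - s) by ring.
rewrite expRD ler_wpM2l ?expR_ge0// expRN powRN.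
have lts : 0 < l * (t - s) by rewrite mulr_gt0.
rewrite lef_pV2 ?posrE ?expR_gt0 ?powR_gt0// powR_le_expR//.
by rewrite ltW//= ler_pdivrMr// mul1r (le_trans q1)// ler1n.
Qed.

Lemma exists_expR_rate K T : 0 <= K -> 0 <= T -> exists2 l, 0 <= l &
  forall t, 0 <= t <= T ->
    K * RL q (fun s => expR (l * s)) t <= 2^-1 * expR (l * t).
Proof.
move=> K0 T0; have p0 : 0 < q / 2 by rewrite divr_gt0.
(* c is chosen so that l = c^(2/q) satisfies l^(q/2) = c. *)
pose c := 2 * (K * (T `^ (q / 2) / (q / 2))) + 1.
have c0 : 0 < c.
  by rewrite ltr_wpDl// !mulr_ge0// ?powR_ge0// invr_ge0 ltW.
exists (c `^ (2 / q)); first exact: powR_ge0.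
move=> t /andP[t0 tT].
have lc : (c `^ (2 / q)) `^ (q / 2) = c.
  have e : 2 / q * (q / 2) = 1 by field; rewrite gt_eqF.
  by rewrite -powRrM e powRr1// ltW.
have l0 : 0 < c `^ (2 / q) by rewrite powR_gt0.
apply: (le_trans (ler_wpM2l K0 (RL_expR_le l0 t0))).
rewrite lc [leLHS](_ : _ = K * (t `^ (q / 2) / (q / 2)) / c
  * expR (c `^ (2 / q) * t)); last by ring.
rewrite ler_wpM2r ?expR_ge0// ler_pdivrMr//.
rewrite (@le_trans _ _ (K * (T `^ (q / 2) / (q / 2))))//; last first.
  by rewrite /c; set X := K * _; lra.
rewrite ler_wpM2l// ler_wpM2r ?invr_ge0 ?(ltW p0)//.
by apply: ge0_ler_powR; rewrite ?nnegrE// ltW.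
Qed.

(** In the norm weighted by e^(-l t), the operator K RL has norm at most 1/2:
    each use of the inequality halves the distance from the bound B on v to
    2 A e^(l t). *)
Lemma gronwall K T A l v : 0 <= K -> 0 <= A -> 0 <= l ->
  (forall t, 0 <= t <= T ->
    K * RL q (fun s => expR (l * s)) t <= 2^-1 * expR (l * t)) ->
  continuous v ->
  (forall t, 0 <= t <= T -> v t <= A + K * RL q v t) ->
  forall t, 0 <= t <= T -> v t <= 2 * A * expR (l * t).
Proof.
move=> K0 A0 l0 lw cv vle.
have [B B0 vB] := continuous_bounded_itv 0 T cv.
have ce := @continuous_expRM l.
have e1 t : 0 <= t -> 1 <= expR (l * t).
  by move=> t0; rewrite -expR0 ler_expR mulr_ge0.
have main n : forall t, 0 <= t <= T ->
    v t <= (2 * A + B / 2 ^+ n) * expR (l * t).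
  elim: n => [|n IH] t /[dup] tT /andP[t0 tT'].
    rewrite expr0 divr1 (le_trans (ler_norm _))// (le_trans (vB _ tT))//.
    rewrite -[leLHS]mulr1 ler_pM ?ler01 ?e1//.
    by rewrite lerDr mulr_ge0.
  apply: (le_trans (vle _ tT)).
  have h : RL q v t <= (2 * A + B / 2 ^+ n) * RL q (fun s => expR (l * s)) t.
    rewrite -kintZ//; apply: kint_le => //.
      by move=> s; apply: cvgM; [exact: cvg_cst|exact: ce].
    by move=> s /andP[s0 st]; apply: IH; rewrite s0 (le_trans (ltW st)).
  have c0 : 0 <= 2 * A + B / 2 ^+ n.
    by rewrite addr_ge0 ?mulr_ge0 ?divr_ge0 ?exprn_ge0.
  have := ler_wpM2l c0 (lw _ tT); have := ler_wpM2l K0 h.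
  have := ler_wpM2l A0 (e1 _ t0).
  rewrite exprS invfM.
  set E := expR _; set P := RL _ _ _; set Q := RL _ _ _; set D := (2 ^+ n)^-1.
  rewrite mulr1 => h1 h2 h3.
  have -> : (2 * A + B * (2^-1 * D)) * E =
    A * E + (2 * A + B * D) * (2^-1 * E) by field.
  apply: lerD => //; apply: le_trans h3; apply: (le_trans h2).
  by rewrite mulrCA.
move=> t tT; rewrite -subr_le0.
apply: (@le0_div_exp2 _ _ (B * expR (l * t))); first by rewrite mulr_ge0 ?expR_ge0.
move=> n; rewrite lerBlDl (le_trans (main n _ tT))// mulrDl.
by rewrite lerD2l mulrAC.
Qed.

End gronwall.

(** * Log-convex sequences and their reciprocal series *)

Section kaluza.
Variables (R : realFieldType) (b : nat -> R).
Hypothesis b0 : forall n, 0 < b n.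
Hypothesis bdecr : forall n, b n.+1 <= b n.
Hypothesis blogconvex : forall n, b n.+1 ^+ 2 <= b n * b n.+2.

(** Prefixes of the sequence of coefficients of the reciprocal of the power
    series with coefficients b; each coefficient is computed from all the
    previous ones, hence the list. *)
Fixpoint inv_prefix (n : nat) : seq R :=
  if n is m.+1 then
    rcons (inv_prefix m)
      (if m is 0 then (b 0)^-1
       else - (b 0)^-1 * \sum_(j < m) nth 0 (inv_prefix m) j * b (m - j)%N)
  else [::].

Definition inv_series (n : nat) : R := nth 0 (inv_prefix n.+1) n.

Lemma size_inv_prefix n : size (inv_prefix n) = n.
Proof. by elim: n => //= n IH; rewrite size_rcons IH. Qed.

Lemma nth_inv_prefix n j : (j < n)%N -> nth 0 (inv_prefix n) j = inv_series j.
Proof.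
elim: n => // n IH; rewrite ltnS leq_eqVlt => /predU1P[->//|jn].
by rewrite -IH//= nth_rcons size_inv_prefix jn.
Qed.

Lemma inv_series0 : inv_series 0 = (b 0)^-1.
Proof. by []. Qed.

Lemma inv_seriesS n : inv_series n.+1 =
  - (b 0)^-1 * \sum_(j < n.+1) inv_series j * b (n.+1 - j)%N.
Proof.
rewrite {1}/inv_series [inv_prefix n.+2]/= nth_rcons size_rcons size_inv_prefix.
rewrite ltnn eqxx.
congr (_ * _); apply: eq_bigr => j _; congr (_ * _).
exact: (@nth_inv_prefix n.+1 j (ltn_ord j)).
Qed.

Lemma inv_series_conv n :
  \sum_(j < n.+1) inv_series j * b (n - j)%N = (n == 0)%:R.
Proof.
case: n => [|n].
  by rewrite big_ord1 inv_series0 /= subn0 mulVf ?eqxx ?gt_eqF.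
rewrite big_ord_recr/= subnn inv_seriesS mulrAC mulNr mulVf ?gt_eqF// mulN1r.
by rewrite subrr.
Qed.

Lemma ratio_le i n : (i <= n)%N -> b i.+1 / b i <= b n.+1 / b n.
Proof.
elim: n => [|n IH]; first by rewrite leqn0 => /eqP ->.
rewrite leq_eqVlt => /predU1P[->//|/IH/le_trans]; apply.
rewrite ler_pdivrMr// mulrAC ler_pdivlMr//.
by rewrite -expr2 mulrC.
Qed.

(** Subtracting b (n+2) / b (n+1) times the equation for the coefficient n+1 from
    the one for n+2 removes the term of index 0, whose coefficient is the only
    positive one; the remaining terms have a sign because the ratios of
    consecutive terms of b increase. *)
Lemma inv_series_le0 n : inv_series n.+1 <= 0.
Proof.
elim/ltn_ind: n => n IH.
rewrite inv_seriesS mulNr oppr_le0 mulr_ge0 ?invr_ge0 ?(ltW (b0 _))//.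
case: n => [|n] in IH *.
  by rewrite big_ord1 inv_series0 mulr_ge0 ?invr_ge0 ?(ltW (b0 _)).
have conv0 : \sum_(j < n.+2) inv_series j * b (n.+1 - j)%N = 0.
  by rewrite inv_series_conv.
have -> : \sum_(j < n.+2) inv_series j * b (n.+2 - j)%N = \sum_(j < n.+2)
    inv_series j * (b (n.+2 - j)%N - b n.+2 / b n.+1 * b (n.+1 - j)%N).
  under [RHS]eq_bigr do rewrite mulrBr mulrCA.
  by rewrite sumrB -mulr_sumr conv0 mulr0 subr0.
apply: sumr_ge0 => -[[|j] /= jn] _.
  by rewrite !subn0 divfK ?subrr ?mulr0 ?gt_eqF.
rewrite mulr_le0 ?IH// subr_le0 subSS subSn//.
rewrite -ler_pdivrMr//.
by apply: ratio_le; rewrite (leq_trans (leq_subr _ _)).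
Qed.

(** In the sum of inv_series j * b (n - j), which is nonnegative, all the b (n - j)
    are at least b n, and all coefficients but the first are nonpositive: so
    replacing them by b n can only increase the sum. *)
Lemma inv_series_sum_ge0 n : 0 <= \sum_(j < n.+1) inv_series j.
Proof.
suff : 0 <= b n * \sum_(j < n.+1) inv_series j by rewrite pmulr_rge0.
have bmono m : b (n + m)%N <= b n.
  by elim: m => [|m IH]; rewrite ?addn0// addnS (le_trans (bdecr _)).
have bmon i j : (i <= j)%N -> b j <= b i.
  move=> ij; rewrite -(subnKC ij); elim: (j - i)%N => [|m IH]; rewrite ?addn0//.
  by rewrite addnS (le_trans (bdecr _)).
have : 0 <= \sum_(j < n.+1) inv_series j * b (n - j)%N by rewrite inv_series_conv.
move=> /le_trans; apply; rewrite mulr_sumr; apply: ler_sum => -[[|j] jn] _ /=.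
  by rewrite subn0 mulrC.
rewrite mulrC ler_wnM2r ?inv_series_le0// bmon//.
exact: leq_subr.
Qed.

Definition conv (u v : nat -> R) (n : nat) : R :=
  \sum_(j < n.+1) u j * v (n - j)%N.

Let P N (u : nat -> R) : {poly R} := \poly_(i < N) u i.

(** Up to a given index, convolution is the product of truncations, which makes
    it associative and commutative. *)
Lemma conv_poly N u v n : (n < N)%N -> conv u v n = (P N u * P N v)`_n.
Proof.
move=> nN; rewrite coefM; apply: eq_bigr => -[j /= jn] _.
by rewrite !coef_poly (leq_trans jn nN) (leq_ltn_trans (leq_subr _ _) nN).
Qed.

Lemma convA u v w n : conv u (conv v w) n = conv (conv u v) w n.
Proof.
have nN := ltnSn n.
transitivity ((P n.+1 u * (P n.+1 v * P n.+1 w))`_n).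
  rewrite coefM; apply: eq_bigr => -[j /= jn] _.
  by rewrite coef_poly jn (@conv_poly n.+1)// ltnS leq_subr.
rewrite mulrA coefM; apply: eq_bigr => -[j /= jn] _.
by rewrite coef_poly ltnS leq_subr (@conv_poly n.+1).
Qed.

Lemma convC u v n : conv u v n = conv v u n.
Proof. by rewrite (@conv_poly n.+1)// (@conv_poly n.+1 v)// mulrC. Qed.

Lemma conv_inv g n : conv inv_series (conv b g) n = g n.
Proof.
rewrite convA /conv big_ord_recl/= inv_series_conv mul1r subn0.
rewrite big1 ?addr0// => j _.
by rewrite inv_series_conv mul0r.
Qed.

(** The discrete counterpart of [RL_sqr_le].  With a the reciprocal series and
    u = b * g, so that g = a * u, the difference 2 g u - a * u^2 at m equals
    u_m^2 (a_0 + ... + a_m) - (sum of a_i (u_(m-i) - u_m)^2), which is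
    nonnegative; convolving with b gives back u^2. *)
Lemma conv_sqr_le g n :
  conv b g n ^+ 2 <= 2 * conv b (fun m => g m * conv b g m) n.
Proof.
set u := conv b g.
have key m : conv inv_series (fun j => u j ^+ 2) m <= 2 * (g m * u m).
  rewrite -{1}(conv_inv g m) -/u {2}/conv.
  rewrite mulr_suml mulr_sumr.
  rewrite -subr_ge0 -sumrB.
  have -> : \sum_(i < m.+1) (2 * (inv_series i * u (m - i)%N * u m) -
      inv_series i * u (m - i)%N ^+ 2) =
    u m ^+ 2 * \sum_(i < m.+1) inv_series i +
    \sum_(i < m.+1) - inv_series i * (u (m - i)%N - u m) ^+ 2.
    rewrite mulr_sumr -big_split/=; apply: eq_bigr => i _; ring.
  apply: addr_ge0.
    by apply: mulr_ge0; [exact: sqr_ge0|exact: inv_series_sum_ge0].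
  apply: sumr_ge0 => -[[|i] im] _ /=.
    by rewrite subn0 subrr expr0n/= mulr0.
  by apply: mulr_ge0; rewrite ?sqr_ge0// oppr_ge0 inv_series_le0.
have -> : u n ^+ 2 = conv b (conv inv_series (fun j => u j ^+ 2)) n.
  rewrite convA /conv big_ord_recl/= -/(conv b inv_series 0) convC.
  rewrite /conv inv_series_conv mul1r subn0 big1 ?addr0// => j _.
  by rewrite -/(conv b inv_series _) convC /conv inv_series_conv mul0r.
rewrite {1 2}/conv mulr_sumr; apply: ler_sum => j _.
by rewrite [leRHS]mulrCA ler_wpM2l ?(ltW (b0 _))// key.
Qed.

End kaluza.

(** * Sampling, and the square of a fractional integral *)

Section sampling.
Variables (R : realType) (q : R).
Hypotheses (q0 : 0 < q) (q1 : q <= 1).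
Implicit Types (h t x y M H : R) (g phi : R -> R) (i n m : nat).

Let cc (c : R) : continuous (fun _ : R => c).
Proof. by move=> ?; exact: cst_continuous. Qed.

Let q10 : q - 1 <= 0. Proof. by rewrite subr_le0. Qed.

(** Both bounds compare the kernel with a constant on an interval of length
    y - x; the constant is written as an integral against the kernel of exponent
    1 - 1 = 0. *)
Lemma powR_diff_ge x y : 0 <= x -> x <= y ->
  (y - x) * y `^ (q - 1) <= (y `^ q - x `^ q) / q.
Proof.
move=> x0 xy; have yx0 : 0 <= y - x by rewrite subr_ge0.
have yxy : y - x <= y by rewrite gerBl.
have xE : y - (y - x) = x by ring.
have := @kint_cst R q q0 0 (y - x) y 1 yx0 yxy.
have := @kint_cst R 1 ltr01 0 (y - x) y (y `^ (q - 1)) yx0 yxy.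
rewrite subr0 mulr1 xE !powRr1// ?(le_trans x0)// divr1 => <- <-.
apply: le_Rintegral => //; [exact: integrable_kernelM|exact: integrable_kernelM|].
move=> s /=; rewrite in_itv/= => /andP[s0 sy].
rewrite subrr powRr0 mul1r mulr1; apply: powR_anti => //.
  by rewrite subr_gt0 (lt_le_trans sy).
by rewrite gerBl.
Qed.

Lemma powR_diff_le x y : 0 < x -> x <= y ->
  (y `^ q - x `^ q) / q <= (y - x) * x `^ (q - 1).
Proof.
move=> x0 xy; have yx0 : 0 <= y - x by rewrite subr_ge0.
have yxy : y - x <= y by rewrite gerBl ltW.
have xE : y - (y - x) = x by ring.
have := @kint_cst R q q0 0 (y - x) y 1 yx0 yxy.
have := @kint_cst R 1 ltr01 0 (y - x) y (x `^ (q - 1)) yx0 yxy.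
rewrite subr0 mulr1 xE !powRr1// ?(le_trans (ltW x0))// ?(ltW x0)// divr1 => <- <-.
apply: le_Rintegral => //; [exact: integrable_kernelM|exact: integrable_kernelM|].
move=> s /=; rewrite in_itv/= => /andP[s0 sy].
rewrite subrr powRr0 mul1r mulr1; apply: powR_anti => //.
by rewrite lerBrDl -lerBrDr ltW.
Qed.

(** [weight h i] is the right Riemann sum, for one interval of length h, of the
    integral [cell h i] of r^(q-1) over [h i, h (i+1)]. *)
Definition weight h i : R := h * (h * i.+1%:R) `^ (q - 1).
Definition cell h i : R := ((h * i.+1%:R) `^ q - (h * i%:R) `^ q) / q.

Lemma weight_gt0 h i : 0 < h -> 0 < weight h i.
Proof. by move=> h0; rewrite mulr_gt0 ?powR_gt0 ?mulr_gt0. Qed.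

Lemma weight_decr h i : 0 < h -> weight h i.+1 <= weight h i.
Proof.
move=> h0; rewrite ler_wpM2l ?(ltW h0)//; apply: powR_anti => //.
  by rewrite mulr_gt0.
by rewrite ler_wpM2l ?(ltW h0)// ler_nat.
Qed.

Lemma weight_logconvex h i : 0 < h ->
  weight h i.+1 ^+ 2 <= weight h i * weight h i.+2.
Proof.
move=> h0; rewrite expr2 /weight mulrACA [leRHS]mulrACA ler_wpM2l ?mulr_ge0 ?(ltW h0)//.
rewrite -!powRM ?mulr_ge0 ?(ltW h0)//; apply: powR_anti => //.
  by rewrite !mulr_gt0.
rewrite mulrACA [leRHS]mulrACA ler_wpM2l ?mulr_ge0 ?(ltW h0)//.
by rewrite -!natrM ler_nat; nia.
Qed.

Lemma weight_le_cell h i : 0 < h -> weight h i <= cell h i.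
Proof.
move=> h0.
have := @powR_diff_ge (h * i%:R) (h * i.+1%:R).
rewrite -mulrBr -natrB// subSnn mulr1; apply.
  by rewrite mulr_ge0// ltW.
by rewrite ler_wpM2l ?(ltW h0)// ler_nat.
Qed.

Lemma cell_le_weight h i : 0 < h -> cell h i.+1 <= weight h i.
Proof.
move=> h0.
have := @powR_diff_le (h * i.+1%:R) (h * i.+2%:R).
rewrite -mulrBr -natrB// subSnn mulr1; apply.
  by rewrite mulr_gt0.
by rewrite ler_wpM2l ?(ltW h0)// ler_nat.
Qed.

Lemma sum_cell h n : \sum_(i < n) cell h i = (h * n%:R) `^ q / q.
Proof.
elim: n => [|n IH]; first by rewrite big_ord0 mulr0 powR0 ?gt_eqF// mul0r.
by rewrite big_ord_recr/= IH /cell -mulrDl addrC subrK.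
Qed.

(** As cell (i+1) <= weight i, the sum telescopes: the error is that of the first
    cell, which touches the singularity. *)
Lemma sum_cell_sub_weight h n : 0 < h ->
  \sum_(i < n) (cell h i - weight h i) <= h `^ q / q.
Proof.
move=> h0; case: n => [|n]; first by rewrite big_ord0 divr_ge0 ?powR_ge0 ?ltW.
suff : \sum_(i < n.+1) (cell h i - weight h i) <= h `^ q / q - weight h n.
  by move/le_trans; apply; rewrite gerBl ltW ?weight_gt0.
elim: n => [|n IH].
  by rewrite big_ord1 /cell mulr1 mulr0 powR0 ?gt_eqF// subr0.
rewrite big_ord_recr/=; apply: (le_trans (lerD IH (lexx _))).
have := @cell_le_weight h n h0.
by move: (cell _ _) (weight _ _) (weight _ _) (_ / _); clear => *; lra.
Qed.

Lemma kint_cells h t g n : 0 <= h -> continuous g ->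
  kint q t (t - h * n%:R) t g =
  \sum_(i < n) kint q t (t - h * i.+1%:R) (t - h * i%:R) g.
Proof.
move=> h0 cg; elim: n => [|n IH].
  by rewrite big_ord0 mulr0 subr0 /kint set_itvco0 Rintegral_set0.
rewrite big_ord_recr/= -IH addrC -kint_cat//.
- by rewrite lerD2l lerN2 ler_wpM2l// ler_nat.
- by rewrite gerBl mulr_ge0.
Qed.

(** On each cell the error has two sources: freezing phi at the right end, which
    costs H h^q times the integral of the kernel, and replacing that integral by
    the weight, which costs M times their difference. *)
Lemma sampling_error h t phi M H n : 0 < h -> t = h * n.+1%:R ->
  continuous phi -> 0 <= H ->
  (forall s, 0 <= s <= t -> `|phi s| <= M) ->
  (forall s s', 0 <= s -> s <= s' -> s' <= t ->
    `|phi s' - phi s| <= H * (s' - s) `^ q) ->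
  `|RL q phi t - conv (weight h) (fun j => phi (h * j.+1%:R)) n| <=
    (M / q + t `^ q / q * H) * h `^ q.
Proof.
move=> h0 tE cphi H0 phiM phiH.
have -> : RL q phi t = kint q t (t - h * n.+1%:R) t phi by rewrite tE subrr.
rewrite (kint_cells _ _ (ltW h0))// /conv -sumrB.
have step (i : 'I_n.+1) :
  `|kint q t (t - h * i.+1%:R) (t - h * i%:R) phi
    - weight h i * phi (h * (n - i).+1%:R)| <=
   cell h i * (H * h `^ q) + (cell h i - weight h i) * M.
  set a := t - h * i.+1%:R; set b := t - h * i%:R.
  have bE : h * (n - i).+1%:R = b.
    rewrite /b tE -mulrBr -natrB ?subSn//; last by rewrite ltnW.
    by rewrite -ltnS.
  have ab : b - a = h.
    by rewrite /a /b -natr1; ring.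
  have ab' : a <= b by rewrite -subr_ge0 ab ltW.
  have a0 : 0 <= a.
    by rewrite /a tE subr_ge0 ler_wpM2l ?(ltW h0)// ler_nat.
  have bt : b <= t by rewrite /b gerBl mulr_ge0// ltW.
  have cellE : ((t - a) `^ q - (t - b) `^ q) / q = cell h i.
    by rewrite /a /b /cell !opprB ![t + _]addrC !subrK.
  have b0 : 0 <= b by rewrite (le_trans a0).
  rewrite bE.
  have -> : kint q t a b phi =
      kint q t a b (fun s => phi s - phi b) + cell h i * phi b.
    rewrite kintD// kint_cst// cellE mulrN subrK//.
  rewrite -addrA -mulrBl; apply: (le_trans (ler_normD _ _)); apply: lerD.
    rewrite -cellE; apply: kint_norm_le => //.
      by move=> s; apply: cvgB; [exact: cphi|exact: cst_continuous].
    move=> s /andP[as_ sb]; rewrite distrC.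
    apply: (le_trans (phiH _ _ (le_trans a0 as_) (ltW sb) bt)).
    rewrite ler_wpM2l//; apply: ge0_ler_powR;
      rewrite ?nnegrE ?subr_ge0 ?(ltW sb)// ?(ltW q0) ?(ltW h0)//.
    by rewrite -ab lerD2l lerN2.
  have cw : 0 <= cell h i - weight h i by rewrite subr_ge0 weight_le_cell.
  by rewrite normrM (ger0_norm cw) ler_wpM2l// phiM// b0.
apply: (le_trans (ler_norm_sum _ _ _)).
apply: (@le_trans _ _ (\sum_(i < n.+1) (cell h i * (H * h `^ q)
    + (cell h i - weight h i) * M))).
  by apply: ler_sum => i _; exact: step.
have M0 : 0 <= M.
  apply: le_trans (phiM 0 _) => //; rewrite lexx tE mulr_ge0//; exact: ltW.
have cellsE : \sum_(i < n.+1) cell h i * (H * h `^ q) =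
    t `^ q / q * (H * h `^ q).
  by rewrite tE -sum_cell mulr_suml.
rewrite big_split/= cellsE -mulr_suml mulrDl addrC; apply: lerD.
  apply: le_trans (ler_wpM2r M0 (sum_cell_sub_weight _ h0)) _.
  by rewrite [leRHS](_ : _ = h `^ q / q * M)//; ring.
by rewrite mulrA.
Qed.

End sampling.

Section square.
Variables (R : realType) (q : R).
Hypotheses (q0 : 0 < q) (q1 : q <= 1).
Implicit Types (t T M H : R) (g : R -> R).

(** The integrated form of the inequality D^q (u^2) <= 2 u D^q u for u = RL q g.
    The sampled version of g at step h = t / (n+1) satisfies it exactly by
    [conv_sqr_le], and the three sampling errors are O(h^q): of u, of u inside
    the convolution, and of the integral of g u. *)
Lemma RL_sqr_le g t M H : 0 <= t -> continuous g -> 0 <= H ->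
  (forall s, 0 <= s <= t -> `|g s| <= M) ->
  (forall s s', 0 <= s -> s <= s' -> s' <= t ->
    `|g s' - g s| <= H * (s' - s) `^ q) ->
  RL q g t ^+ 2 <= 2 * RL q (fun s => g s * RL q g s) t.
Proof.
rewrite le_eqVlt => /predU1P[<-|t0] cg H0 gM gH.
  by rewrite !RL_le0// expr0n/= mulr0.
have M0 : 0 <= M by rewrite (le_trans (normr_ge0 _) (gM 0 _))// lexx ltW.
have iq0 : 0 <= q^-1 by rewrite invr_ge0 ltW.
pose U := RL q g.
have [E EE] : exists E, E = t `^ q / q by exists (t `^ q / q).
pose D := E * M.
have E0 : 0 <= E by rewrite EE divr_ge0 ?powR_ge0 ?ltW.
have D0 : 0 <= D by rewrite mulr_ge0.
have cU : continuous U by exact: continuous_RL.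
have tqE s : 0 <= s <= t -> s `^ q / q <= E.
  move=> /andP[s0 st]; rewrite EE ler_wpM2r ?invr_ge0 ?(ltW q0)//.
  by apply: ge0_ler_powR; rewrite ?nnegrE// ltW.
have UD s : 0 <= s <= t -> `|U s| <= D.
  move=> /[dup] s0t /andP[s0 st].
  apply: (@le_trans _ _ (s `^ q / q * M)); last by rewrite ler_wpM2r// tqE.
  apply: RL_norm_le => // r /andP[r0 rs]; apply: gM.
  by rewrite r0 (le_trans rs).
have UH s s' : 0 <= s -> s <= s' -> s' <= t ->
    `|U s' - U s| <= 2 * M / q * (s' - s) `^ q.
  move=> s0 ss' s't; apply: RL_holder => // r /andP[r0 rs]; apply: gM.
  by rewrite r0 (le_trans rs).
clearbody D; pose gU s := g s * U s.
have cgU : continuous gU by move=> s; apply: cvgM; [exact: cg|exact: cU].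
have gUM s : 0 <= s <= t -> `|gU s| <= M * D.
  by move=> st; rewrite normrM ler_pM ?gM ?UD.
pose H2 := M * (2 * M / q) + H * D.
have H20 : 0 <= H2.
  by rewrite !(addr_ge0,mulr_ge0).
have gUH s s' : 0 <= s -> s <= s' -> s' <= t ->
    `|gU s' - gU s| <= H2 * (s' - s) `^ q.
  move=> s0 ss' s't.
  have -> : gU s' - gU s = g s' * (U s' - U s) + (g s' - g s) * U s.
    rewrite /gU; move: (U s) (U s') (g s) (g s') => *; ring.
  rewrite /H2 [leRHS]mulrDl; apply: (le_trans (ler_normD _ _)).
  rewrite !normrM; apply: lerD.
    by rewrite -mulrA ler_pM ?UH// gM// s't (le_trans s0).
  by rewrite [leRHS]mulrAC ler_pM ?gH// UD// s0 (le_trans ss').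
clearbody H2.
pose C1 := M / q + E * H; pose C2 := M * D / q + E * H2.
have C10 : 0 <= C1 by rewrite !(addr_ge0,mulr_ge0).
have C20 : 0 <= C2 by rewrite !(addr_ge0,mulr_ge0).
rewrite -subr_le0.
apply: (@le0_vanishing_powR _ q _
  (C1 * (2 * D + C1 * t `^ q) + 2 * (E * (M * C1)) + 2 * C2) t) => // [||n].
- by rewrite !(addr_ge0,mulr_ge0,powR_ge0).
- exact: ltW.
pose h := t / n.+1%:R.
have h0 : 0 < h by rewrite divr_gt0.
have tE : t = h * n.+1%:R by rewrite divfK.
have hle (m : nat) : (m <= n)%N -> h * m.+1%:R <= t.
  by move=> mn; rewrite tE ler_wpM2l ?(ltW h0)// ler_nat.
have hge (m : nat) : 0 <= h * m.+1%:R by rewrite mulr_ge0 ?(ltW h0).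
pose b := weight q h; pose gj (j : nat) := g (h * j.+1%:R).
pose u := conv b gj.
have eu m : (m <= n)%N -> `|U (h * m.+1%:R) - u m| <= C1 * h `^ q.
  move=> mn; have mt := hle _ mn.
  apply: (@le_trans _ _ ((M / q + (h * m.+1%:R) `^ q / q * H) * h `^ q)).
    apply: sampling_error => //.
      by move=> s /andP[s0 st]; rewrite gM// s0 (le_trans st).
    by move=> s s' s0 ss' s't; rewrite gH// (le_trans s't).
  by rewrite ler_wpM2r ?powR_ge0// lerD2l ler_wpM2r// tqE// hge.
have egU : `|RL q gU t - conv b (fun j => gU (h * j.+1%:R)) n| <= C2 * h `^ q.
  by rewrite /C2 EE; exact: sampling_error.
have kal : u n ^+ 2 <= 2 * conv b (fun m => gj m * u m) n.
  apply: conv_sqr_le => i; [exact: weight_gt0|exact: weight_decr|].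
  exact: weight_logconvex.
have sumb : \sum_(i < n.+1) b i <= E.
  rewrite EE {1}tE -sum_cell//; apply: ler_sum => i _; exact: weight_le_cell.
have ec : `|conv b (fun m => gj m * u m) n
      - conv b (fun j => gU (h * j.+1%:R)) n| <= E * (M * (C1 * h `^ q)).
  rewrite /conv -sumrB; apply: (le_trans (ler_norm_sum _ _ _)).
  apply: (@le_trans _ _ (\sum_(i < n.+1) b i * (M * (C1 * h `^ q)))).
    apply: ler_sum => i _; have bi := ltW (weight_gt0 q i h0).
    rewrite -mulrBr normrM (ger0_norm bi) ler_wpM2l// /gU -mulrBr normrM.
    rewrite ler_pM//.
      by rewrite gM// hge hle// leq_subr.
    by rewrite distrC eu// leq_subr.
  by rewrite -mulr_suml ler_wpM2r// !mulr_ge0// powR_ge0.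
have htq : h `^ q <= t `^ q.
  apply: ge0_ler_powR; rewrite ?nnegrE ?(ltW h0) ?(ltW t0) ?(ltW q0)//.
  by rewrite tE ler_peMr ?(ltW h0)// ler1n.
have eUu : U t ^+ 2 - u n ^+ 2 <= C1 * (2 * D + C1 * t `^ q) * h `^ q.
  have e1 := eu n (leqnn n); rewrite -tE in e1.
  have UDt : `|U t| <= D by rewrite UD// lexx ltW.
  have -> : U t ^+ 2 - u n ^+ 2 = (U t - u n) * (2 * U t - (U t - u n)) by ring.
  apply: (le_trans (ler_norm _)); rewrite normrM mulrAC ler_pM//.
  apply: (le_trans (ler_normB _ _)); rewrite normrM ger0_norm//; apply: lerD.
    by rewrite ler_wpM2l.
  by rewrite (le_trans e1)// ler_wpM2l.
move: ec egU; rewrite -/gU !ler_norml => /andP[_ ec] /andP[egU _].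
move: eUu kal ec egU; rewrite -/h -/U -/u -/b.
have -> : E * (M * (C1 * h `^ q)) = E * (M * C1) * h `^ q by rewrite !mulrA.
move: (u n) (conv b _ n) (conv b _ n) (RL q gU t) (U t ^+ 2) => un c1 c2 r Ut.
clearbody C2; clear C20.
move: (C1 * (2 * D + C1 * t `^ q)) (E * (M * C1)) C2 (h `^ q) (un ^+ 2).
by clear=> *; lra.
Qed.

End square.

(** * Column-valued functions *)

Section column_vectors.
Variables (R : realType) (n : nat).
Implicit Types x y : 'cV[R]_n.

Lemma coord_le_norm x i : `|x i 0| <= `|x|.
Proof.
rewrite [leRHS]/Num.norm/= mx_normrE.
by apply: le_trans (le_bigmax _ _ (i, 0)).
Qed.

Lemma norm_le_coord x r : 0 <= r -> (forall i, `|x i 0| <= r) -> `|x| <= r.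
Proof.
move=> r0 xr; rewrite [leLHS]/Num.norm/= mx_normrE.
by apply/bigmax_leP; split => // -[i j] _ /=; rewrite (ord1 j).
Qed.

Lemma continuous_coord (f : R -> 'cV[R]_n) i :
  continuous f -> continuous (fun s => f s i 0).
Proof.
move=> cf s; apply: (@continuous_comp _ _ _ f (fun x : 'cV[R]_n => x i 0)).
  exact: cf.
exact: coord_continuous.
Qed.

Lemma continuous_col (f : R -> 'cV[R]_n) :
  (forall i, continuous (fun s => f s i 0)) -> continuous f.
Proof.
move=> cf s; apply/cvgrPdist_le => e e0; near=> r.
apply: norm_le_coord => [|i]; first exact: ltW.
rewrite !mxE; move: i; near: r; apply: filter_forall => i.
by have /cvgrPdist_le := cf i s; apply.
Unshelve. all: by end_near. Qed.

End column_vectors.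

Definition locally_lipschitz (R : realType) (n : nat) (F : 'cV[R]_n -> 'cV[R]_n) :=
  forall M : R, 0 <= M -> exists2 L, 0 <= L &
    forall x y, `|x| <= M -> `|y| <= M -> `|F x - F y| <= L * `|x - y|.

Lemma continuous_lipschitz_comp (R : realType) (n : nat)
    (F : 'cV[R]_n -> 'cV[R]_n) (x : R -> 'cV[R]_n) :
  locally_lipschitz F -> continuous x -> continuous (fun s => F (x s)).
Proof.
move=> lF cx t.
have [L L0 FL] := lF (`|x t| + 1) (addr_ge0 (normr_ge0 _) ler01).
have /cvgrPdist_lt xt := cx t.
apply/cvgrPdist_lt => e e0.
have L1 : 0 < L + 1 by rewrite ltr_wpDl.
have eL : 0 < e / (L + 1) by rewrite divr_gt0.
near=> s.
have xy1 : `|x t - x s| <= 1 by apply/ltW; near: s; exact: xt.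
have xye : `|x t - x s| < e / (L + 1) by near: s; exact: xt.
apply: (@le_lt_trans _ _ (L * `|x t - x s|)).
  apply: FL; first by rewrite lerDl.
  by rewrite -[x s](subKr (x t)) (le_trans (ler_normB _ _))// lerD2l.
apply: (@le_lt_trans _ _ (L * (e / (L + 1)))); first by rewrite ler_wpM2l// ltW.
by rewrite mulrA ltr_pdivrMr// mulrC ltr_pM2l// ltrDl.
Unshelve. all: by end_near. Qed.

(** Solutions are only given on [0, T]; precomposed with the projection onto
    [0, T] they become continuous on the whole line. *)
Definition clamp (R : realType) (T t : R) : R := Num.min (Num.max t 0) T.

Section clamp.
Variables (R : realType) (T : R).
Hypothesis T0 : 0 <= T.

Lemma clamp_itv t : 0 <= clamp T t <= T.
Proof. by rewrite /clamp ge_min lexx orbT le_min le_max lexx orbT T0. Qed.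

Lemma clamp_id t : 0 <= t <= T -> clamp T t = t.
Proof. by move=> /andP[t0 tT]; rewrite /clamp max_l// min_l. Qed.

Lemma clamp_dist s t : `|clamp T s - clamp T t| <= `|s - t|.
Proof.
have := ler_norm (s - t); have := ler_norm (t - s); rewrite (distrC t s).
move: `|s - t| => d; rewrite /clamp /Num.min /Num.max ler_norml.
by do ![case: ifPn]; rewrite -?leNgt => *; apply/andP; split; lra.
Qed.

Lemma continuous_clamp : continuous (clamp T).
Proof.
move=> t; apply/cvgrPdist_lt => e e0; near=> s.
apply: (le_lt_trans (clamp_dist _ _)); near: s; exact: cvgr_dist_lt.
Unshelve. all: by end_near. Qed.

Lemma continuous_comp_clamp (V : topologicalType) (f : R -> V) :
  {within `[0, T], continuous f} -> continuous (fun t => f (clamp T t)).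
Proof.
move=> /subspace_continuousP cf t.
have ct : `[0, T]%classic (clamp T t) by rewrite /= in_itv/= clamp_itv.
apply: cvg_comp (cf _ ct).
move=> A wA.
have : \forall s \near t, `[0, T]%classic (clamp T s) -> A (clamp T s).
  exact: (continuous_clamp wA).
apply: (@filterS _ (nbhs t)) => s; apply.
by rewrite /= in_itv/= clamp_itv.
Qed.

End clamp.

(** * Volterra equations with a weakly singular kernel *)

Section volterra.
Variables (R : realType) (n : nat) (q G : R) (x0 : 'cV[R]_n) (T : R).
Hypotheses (q0 : 0 < q) (q1 : q <= 1) (G0 : 0 <= G) (T0 : 0 <= T).
Implicit Types (F : 'cV[R]_n -> 'cV[R]_n) (x y : R -> 'cV[R]_n).

Definition volterra_op F x (t : R) : 'cV[R]_n :=
  x0 + \col_i (G * RL q (fun s => F (x s) i 0) t).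

Definition volterra F x := forall t, 0 <= t <= T -> x t = volterra_op F x t.

Lemma continuous_volterra_op F x : locally_lipschitz F -> continuous x ->
  continuous (volterra_op F x).
Proof.
move=> lF cx; apply: continuous_col => i.
rewrite (_ : (fun _ => _) =
    (fun t => x0 i 0 + G * RL q (fun s => F (x s) i 0) t)); last first.
  by apply/funext => t; rewrite !mxE.
move=> t; apply: cvgD; first exact: cvg_cst.
apply: cvgM; first exact: cvg_cst.
apply: continuous_RL => //.
exact/continuous_coord/continuous_lipschitz_comp.
Qed.

Lemma volterra_op_dist F x y L M t : locally_lipschitz F ->
  continuous x -> continuous y -> 0 <= t -> 0 <= L ->
  (forall u v, `|u| <= M -> `|v| <= M -> `|F u - F v| <= L * `|u - v|) ->
  (forall s, 0 <= s <= t -> `|x s| <= M) ->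
  (forall s, 0 <= s <= t -> `|y s| <= M) ->
  `|volterra_op F x t - volterra_op F y t| <=
    G * L * RL q (fun s => `|x s - y s|) t.
Proof.
move=> lF cx cy t0 L0 FL xM yM.
have cd := continuous_dist cx cy.
have RLd0 : 0 <= RL q (fun s => `|x s - y s|) t.
  by apply: Rintegral_ge0 => s _; rewrite mulr_ge0 ?powR_ge0.
apply: norm_le_coord => [|i]; first by rewrite !mulr_ge0.
rewrite !mxE opprD addrACA subrr add0r -mulrBr normrM (ger0_norm G0) -mulrA.
rewrite ler_wpM2l// /RL -kintZ//.
apply: RL_dist_le => //.
- exact/continuous_coord/continuous_lipschitz_comp.
- exact/continuous_coord/continuous_lipschitz_comp.
- by move=> s; apply: cvgM; [exact: cvg_cst|exact: cd].
move=> s st; apply: le_trans (FL _ _ (xM _ st) (yM _ st)).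
by have := coord_le_norm (F (x s) - F (y s)) i; rewrite !mxE.
Qed.

Lemma continuous_bounded_norm x : continuous x ->
  exists2 M, 0 <= M & forall s, 0 <= s <= T -> `|x s| <= M.
Proof.
move=> cx.
have [M M0 xM] := continuous_bounded_itv 0 T (continuous_norm_of cx).
by exists M => // s sT; have := xM s sT; rewrite normr_id.
Qed.

Lemma volterra_unique F x y : locally_lipschitz F ->
  continuous x -> continuous y -> volterra F x -> volterra F y ->
  forall t, 0 <= t <= T -> x t = y t.
Proof.
move=> lF cx cy vx vy.
have [Mx Mx0 xM] := continuous_bounded_norm cx.
have [My My0 yM] := continuous_bounded_norm cy.
have [L L0 FL] := lF _ (addr_ge0 Mx0 My0).
have GL0 : 0 <= G * L by rewrite mulr_ge0.
have [l l0 lw] := exists_expR_rate q0 q1 GL0 T0.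
have cd := continuous_dist cx cy.
have h := gronwall q0 GL0 (lexx 0) l0 lw cd.
move=> t tT; apply/eqP; rewrite -subr_eq0 -normr_le0.
have {h} := h _ t tT; rewrite mulr0 mul0r; apply => s /[dup] sT /andP[s0 s1].
rewrite add0r vx// vy//; apply: (@volterra_op_dist _ _ _ _ (Mx + My)) => //.
  by move=> r /andP[r0 rs]; rewrite (le_trans (xM _ _)) ?lerDl// r0 (le_trans rs).
by move=> r /andP[r0 rs]; rewrite (le_trans (yM _ _)) ?lerDr// r0 (le_trans rs).
Qed.

Lemma volterra_op_holder F x B : locally_lipschitz F -> continuous x ->
  (forall s, 0 <= s <= T -> `|F (x s)| <= B) ->
  forall t t', t <= T -> t' <= T ->
  `|volterra_op F x t - volterra_op F x t'| <= G * (2 * B / q) * `|t - t'| `^ q.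
Proof.
move=> lF cx FB t t' tT t'T.
have B0 : 0 <= B by rewrite (le_trans (normr_ge0 _) (FB 0 _))// lexx.
have iq0 : 0 <= q^-1 by rewrite invr_ge0 ltW.
apply: norm_le_coord => [|i]; first by rewrite !(mulr_ge0,powR_ge0).
rewrite !mxE opprD addrACA subrr add0r -mulrBr normrM (ger0_norm G0) -mulrA.
rewrite ler_wpM2l//; apply: (@RL_holder_abs _ _ _ _ _ T) => //.
  exact/continuous_coord/continuous_lipschitz_comp.
by move=> s sT; rewrite (le_trans (coord_le_norm _ _))// FB.
Qed.

End volterra.

Section picard.
Variables (R : realType) (n : nat) (q G : R) (x0 : 'cV[R]_n) (T : R).
Hypotheses (q0 : 0 < q) (q1 : q <= 1) (G0 : 0 <= G) (T0 : 0 <= T).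
Variables (F : 'cV[R]_n -> 'cV[R]_n) (L B : R).
Hypotheses (L0 : 0 <= L) (FL : forall x y, `|F x - F y| <= L * `|x - y|)
  (FB : forall x, `|F x| <= B).

Let X (k : nat) : R -> 'cV[R]_n := iter k (volterra_op q G x0 F) (fun=> x0).

Let lF : locally_lipschitz F.
Proof. by move=> M _; exists L. Qed.

Let B0 : 0 <= B. Proof. exact: le_trans (normr_ge0 _) (FB 0). Qed.

Let iq0 : 0 <= q^-1. Proof. by rewrite invr_ge0 ltW. Qed.

Let cX k : continuous (X k).
Proof.
elim: k => [|k IH]; first by move=> ?; exact: cst_continuous.
exact: continuous_volterra_op.
Qed.

Let volterra_op_lip x y t : continuous x -> continuous y -> 0 <= t ->
  `|volterra_op q G x0 F x t - volterra_op q G x0 F y t| <=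
    G * L * RL q (fun s => `|x s - y s|) t.
Proof.
move=> cx cy t0.
have [Mx Mx0 xM] := continuous_bounded_norm t cx.
have [My My0 yM] := continuous_bounded_norm t cy.
apply: (@volterra_op_dist _ _ _ _ _ _ _ _ _ _ _ (Mx + My)) => //.
  by move=> s st; rewrite (le_trans (xM _ st))// lerDl.
by move=> s st; rewrite (le_trans (yM _ st))// lerDr.
Qed.

(** In the norm weighted by e^(-l t) the Volterra operator is a contraction of
    ratio 1/2.  The limit of the iterates inherits their common Hoelder bound,
    which holds because F is bounded. *)
Lemma exists_volterra_lipschitz :
  exists2 x : R -> 'cV[R]_n, continuous x & volterra q G x0 T F x.
Proof.
have GL0 : 0 <= G * L by rewrite mulr_ge0.
have [l l0 lw] := exists_expR_rate q0 q1 GL0 T0.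
have ce := @continuous_expRM R l.
pose C := G * (T `^ q / q * B).
have C0 : 0 <= C by rewrite !(mulr_ge0,powR_ge0).
have step k : forall t, 0 <= t <= T ->
    `|X k.+1 t - X k t| <= C / 2 ^+ k * expR (l * t).
  elim: k => [|k IH] t /[dup] tT /andP[t0 t1].
    rewrite expr0 divr1 -[leLHS]mulr1 ler_pM ?ler01//; last first.
      by rewrite -expR0 ler_expR mulr_ge0.
    rewrite /X/= /volterra_op addrC addrA addNr add0r.
    apply: norm_le_coord => // i; rewrite mxE normrM (ger0_norm G0) ler_wpM2l//.
    have cc : continuous (fun _ : R => F x0 i 0) by move=> ?; exact: cst_continuous.
    apply: (le_trans (@RL_norm_le _ _ q0 _ _ B t0 cc _)).
      by move=> s _; rewrite (le_trans (coord_le_norm _ _)).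
    rewrite ler_wpM2r// ler_wpM2r//.
    by apply: ge0_ler_powR; rewrite ?nnegrE// ltW.
  have h : `|X k.+2 t - X k.+1 t| <=
      G * L * RL q (fun s => `|X k.+1 s - X k s|) t.
    exact: (volterra_op_lip (@cX k.+1) (@cX k) t0).
  apply: (le_trans h).
  apply: (@le_trans _ _ (G * L * (C / 2 ^+ k * RL q (fun s => expR (l * s)) t))).
    rewrite ler_wpM2l// /RL -kintZ//; apply: kint_le => //.
    - exact: continuous_dist (@cX k.+1) (@cX k).
    - by move=> s; apply: cvgM; [exact: cvg_cst|exact: ce].
    - by move=> s /andP[s0 st]; apply: IH; rewrite s0 (le_trans (ltW st)).
  have := ler_wpM2l (divr_ge0 C0 (exprn_ge0 k (ler0n R 2))) (lw t tT).
  rewrite exprS invfM; set E := expR _; set Q := RL _ _ _; set D := (2 ^+ k)^-1.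
  have -> : G * L * (C * D * Q) = C * D * (G * L * Q) by ring.
  by have -> : C * (2^-1 * D) * E = C * D * (2^-1 * E) by ring.
(* A bound for the weighted distances that is uniform on [0, T]. *)
have [D DE] : exists D, D = C * expR (l * T) by exists (C * expR (l * T)).
have D0 : 0 <= D by rewrite DE mulr_ge0 ?expR_ge0.
have [x xX] : exists x : R -> 'cV[R]_n, forall t, 0 <= t <= T ->
    forall k, `|x t - X k t| <= 2 * D / 2 ^+ k.
  suff : forall t, exists y : 'cV[R]_n, 0 <= t <= T -> forall k,
      `|y - X k t| <= 2 * D / 2 ^+ k.
    by move=> /choice[f fP]; exists f.
  move=> t; have [tT|/negP tT] := boolP (0 <= t <= T); last by exists 0.
  have XD (i : 'I_n) k : `|X k.+1 t i 0 - X k t i 0| <= D / 2 ^+ k.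
    apply: (@le_trans _ _ `|X k.+1 t - X k t|).
      by have := coord_le_norm (X k.+1 t - X k t) i; rewrite !mxE.
    apply: (le_trans (step k t tT)); rewrite DE [leRHS]mulrAC.
    rewrite ler_wpM2l ?divr_ge0 ?exprn_ge0// ler_expR ler_wpM2l//.
    by case/andP: tT.
  have /choice[y yX] : forall i, exists l, forall k,
      `|l - X k t i 0| <= 2 * D / 2 ^+ k.
    by move=> i; exact: sequence_geometric_limit (XD i).
  exists (\col_i y i) => _ k; apply: norm_le_coord => [|i].
    by rewrite divr_ge0 ?mulr_ge0 ?exprn_ge0.
  by rewrite !mxE.
pose H := G * (2 * B / q).
have H0 : 0 <= H by rewrite !mulr_ge0.
have XH k s t : s <= T -> t <= T -> `|X k s - X k t| <= H * `|s - t| `^ q.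
  move=> sT tT; case: k => [|k]; first by rewrite subrr normr0 mulr_ge0 ?powR_ge0.
  by apply: (@volterra_op_holder _ _ _ _ _ T).
have xH s t : 0 <= s <= T -> 0 <= t <= T -> `|x s - x t| <= H * `|s - t| `^ q.
  move=> sT tT; rewrite -subr_le0.
  apply: (@le0_div_exp2 _ _ (4 * D)) => [|k]; first by rewrite mulr_ge0.
  rewrite lerBlDr.
  have -> : x s - x t = (x s - X k s) + (X k s - X k t) - (x t - X k t).
    by rewrite addrA subrK opprB addrA subrK.
  have hs := xX s sT k; have ht := xX t tT k.
  have hk : `|X k s - X k t| <= H * `|s - t| `^ q.
    by apply: XH; [case/andP: sT|case/andP: tT].
  apply: (le_trans (ler_normB _ _)).
  rewrite (_ : 4 * D / 2 ^+ k = 2 * D / 2 ^+ k + 2 * D / 2 ^+ k); last by ring.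
  have := ler_normD (x s - X k s) (X k s - X k t).
  move: hs ht hk; set a := _ / _; set b := _ * _ `^ _.
  move: a b `|_| `|_| `|_| `|_| => a b r1 r2 r3 r4.
  by lra.
pose xc t := x (clamp T t).
have cxc : continuous xc.
  apply: (@continuous_of_holder _ _ q) => // t; exists H => // s _.
  apply: (le_trans (xH _ _ (clamp_itv T0 _) (clamp_itv T0 _))).
  rewrite ler_wpM2l//; apply: ge0_ler_powR; rewrite ?nnegrE ?(ltW q0)//.
  exact: clamp_dist.
exists xc => // t /[dup] tT /andP[t0 t1]; apply/eqP; rewrite -subr_eq0 -normr_le0.
pose E := G * L * (T `^ q / q).
have E0 : 0 <= E by rewrite !(mulr_ge0,powR_ge0).
apply: (@le0_div_exp2 _ _ (2 * D + E * (2 * D))) => [|k].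
  by apply: addr_ge0; [exact: mulr_ge0|apply: mulr_ge0 => //; exact: mulr_ge0].
have -> : xc t - volterra_op q G x0 F xc t = (x t - X k.+1 t) +
    (volterra_op q G x0 F (X k) t - volterra_op q G x0 F xc t).
  by rewrite addrA subrK /xc clamp_id.
apply: (le_trans (ler_normD _ _)); rewrite mulrDl; apply: lerD.
  apply: (le_trans (xX t tT k.+1)); rewrite ler_wpM2l ?mulr_ge0//.
  by rewrite lef_pV2 ?posrE ?exprn_gt0// ler_eXn2l ?ltr1n.
apply: (le_trans (volterra_op_lip (@cX k) cxc t0)).
rewrite /E -!mulrA ler_wpM2l// ler_wpM2l//.
apply: (le_trans (ler_norm _)).
have cd := continuous_dist (@cX k) cxc.
apply: (le_trans (@RL_norm_le _ _ q0 _ _ (2 * D / 2 ^+ k) t0 cd _)).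
  move=> s /andP[s0 st]; have sT : 0 <= s <= T by rewrite s0 (le_trans st).
  by rewrite normr_id distrC /xc clamp_id// xX.
rewrite -!mulrA ler_wpM2r ?mulr_ge0 ?invr_ge0 ?exprn_ge0 ?(ltW q0)//.
by apply: ge0_ler_powR; rewrite ?nnegrE// ltW.
Qed.

End picard.

(** * Energy estimates and global existence *)

Section energy.
Variables (R : realType) (n : nat) (q G : R) (x0 : 'cV[R]_n) (T : R).
Hypotheses (q0 : 0 < q) (q1 : q <= 1) (G0 : 0 <= G) (T0 : 0 <= T).
Variables (w : 'I_n -> R).
Hypothesis w0 : forall i, 0 < w i.
Implicit Types (F : 'cV[R]_n -> 'cV[R]_n) (x : R -> 'cV[R]_n) (v : 'cV[R]_n).

Definition energy (v : 'cV[R]_n) : R := \sum_i w i * v i 0 ^+ 2.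
(** Half of the derivative of [energy] along the ordinary differential equation
    v' = F v. *)
Definition energy_rate F (v : 'cV[R]_n) : R := \sum_i w i * (v i 0 * F v i 0).

Lemma energy_ge0 v : 0 <= energy v.
Proof. by apply: sumr_ge0 => i _; rewrite mulr_ge0 ?sqr_ge0 ?ltW. Qed.

Lemma sqr_coord_le_energy v i : v i 0 ^+ 2 <= energy v / w i.
Proof.
rewrite ler_pdivlMr// mulrC /energy (bigD1 i)//= lerDl.
by apply: sumr_ge0 => j _; rewrite mulr_ge0 ?sqr_ge0 ?ltW.
Qed.

(** In each coordinate x = x0 + G RL g; expanding the square and applying
    [RL_sqr_le] to g turns G^2 (RL g)^2 into 2 G RL (g * G RL g), which
    recombines with the cross term into 2 G RL (g x).  The Hoelder continuity
    that [RL_sqr_le] asks of g comes from that of x. *)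
Lemma volterra_energy_le F x : locally_lipschitz F -> continuous x ->
  volterra q G x0 T F x -> forall t, 0 <= t <= T ->
  energy (x t) <= energy x0 + 2 * G * RL q (fun s => energy_rate F (x s)) t.
Proof.
move=> lF cx vx t /[dup] tT /andP[t0 t1].
have cF := continuous_lipschitz_comp lF cx.
have [M M0 xM] := continuous_bounded_norm T cx.
have [B B0 FB] := continuous_bounded_norm T cF.
have [L L0 FL] := lF _ M0.
pose g i s := F (x s) i 0.
have cg i : continuous (g i) by exact/continuous_coord.
have cxi i : continuous (fun s => x s i 0) by exact/continuous_coord.
have sT s : 0 <= s <= t -> 0 <= s <= T.
  by move=> /andP[s0 st]; rewrite s0 (le_trans st).
have gB i s : 0 <= s <= t -> `|g i s| <= B.
  by move=> /sT sT'; rewrite (le_trans (coord_le_norm _ _))// FB.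
pose H := L * (G * (2 * B / q)).
have H0 : 0 <= H by rewrite !mulr_ge0// invr_ge0 ltW.
have gH i s s' : 0 <= s -> s <= s' -> s' <= t ->
    `|g i s' - g i s| <= H * (s' - s) `^ q.
  move=> s0 ss' s't.
  have h1 : 0 <= s <= T by rewrite s0 (le_trans ss')// (le_trans s't).
  have h2 : 0 <= s' <= T by rewrite (le_trans s0)//= (le_trans s't).
  have := coord_le_norm (F (x s') - F (x s)) i; rewrite !mxE => /le_trans; apply.
  apply: (le_trans (FL _ _ (xM _ h2) (xM _ h1))).
  rewrite /H -mulrA ler_wpM2l// vx// [x s]vx//.
  rewrite -[s' - s]ger0_norm ?subr_ge0//.
  apply: (@volterra_op_holder _ _ _ _ _ T) => //; [by case/andP: h2|by case/andP: h1].
pose P i s := x s i 0 * g i s.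
have cP i : continuous (P i).
  by move=> s; apply: cvgM; [exact: cxi|exact: cg].
have coord i : x t i 0 ^+ 2 <= x0 i 0 ^+ 2 + 2 * G * RL q (P i) t.
  have xE s : 0 <= s <= T -> x s i 0 = x0 i 0 + G * RL q (g i) s.
    by move=> /vx ->; rewrite !mxE.
  pose Q s := g i s * RL q (g i) s.
  have cQ : continuous Q.
    by move=> s; apply: cvgM; [exact: cg|exact: continuous_RL].
  have -> : RL q (P i) t = x0 i 0 * RL q (g i) t + G * RL q Q t.
    rewrite /RL -!kintZ// -kintD//; last 2 first.
    - by move=> s; apply: cvgM; [exact: cvg_cst|exact: cg].
    - by move=> s; apply: cvgM; [exact: cvg_cst|exact: cQ].
    apply: eq_Rintegral => s; rewrite inE/= in_itv/= => /andP[s0 st].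
    congr (_ * _); rewrite /P xE /Q /RL; first by ring.
    by rewrite s0 ltW// (lt_le_trans st).
  have := RL_sqr_le q0 q1 t0 (cg i) H0 (gB i) (gH i); rewrite -/Q xE//.
  move: (RL q (g i) t) (RL q Q t) (x0 i 0) => u v z uv.
  have -> : (z + G * u) ^+ 2 = z ^+ 2 + 2 * G * (z * u) + G ^+ 2 * u ^+ 2 by ring.
  have -> : z ^+ 2 + 2 * G * (z * u + G * v) =
    z ^+ 2 + 2 * G * (z * u) + G ^+ 2 * (2 * v) by ring.
  by rewrite lerD2l ler_wpM2l// sqr_ge0.
rewrite /RL /energy_rate kint_sum//; last first.
  by move=> i s; apply: cvgM; [exact: cvg_cst|exact: cP].
rewrite mulr_sumr /energy -big_split/=; apply: ler_sum => i _.
rewrite kintZ//; last exact: cP.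
by rewrite [2 * G * _]mulrCA -mulrDr ler_wpM2l ?(ltW (w0 i)).
Qed.

(** K is chosen before F: the same bound holds for all the truncations of a
    field. *)
Lemma a_priori_bound C : 0 <= C ->
  exists K, forall F x, locally_lipschitz F -> continuous x ->
    (forall v, energy_rate F v <= C * energy v) ->
    volterra q G x0 T F x -> forall t, 0 <= t <= T -> energy (x t) <= K.
Proof.
move=> C0.
have GC0 : 0 <= 2 * G * C by rewrite !mulr_ge0.
have [l l0 lw] := exists_expR_rate q0 q1 GC0 T0.
exists (2 * energy x0 * expR (l * T)) => F x lF cx FC vx.
have cF := continuous_lipschitz_comp lF cx.
have cxi i : continuous (fun s => x s i 0) by exact/continuous_coord.
have cFi i : continuous (fun s => F (x s) i 0) by exact/continuous_coord.
have cE : continuous (fun s => energy (x s)).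
  apply: continuous_sum => i s; apply: cvgM; first exact: cvg_cst.
  by rewrite /=; under eq_fun do rewrite expr2; apply: cvgM; exact: cxi.
have cPw : continuous (fun s => energy_rate F (x s)).
  apply: continuous_sum => i s; apply: cvgM; first exact: cvg_cst.
  by apply: cvgM; [exact: cxi|exact: cFi].
have gr := gronwall q0 GC0 (energy_ge0 x0) l0 lw cE.
move=> t tT; apply: (@le_trans _ _ (2 * energy x0 * expR (l * t))); last first.
  rewrite ler_wpM2l ?mulr_ge0 ?energy_ge0// ler_expR ler_wpM2l//.
  by case/andP: tT.
apply: gr => // s /[dup] sT /andP[s0 s1].
apply: (le_trans (volterra_energy_le lF cx vx sT)).
rewrite lerD2l -[leRHS]mulrA ler_wpM2l ?mulr_ge0// /RL -kintZ//.
apply: kint_le => //.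
by move=> r; apply: cvgM; [exact: cvg_cst|exact: cE].
Qed.

Definition radial_retract (M : R) (v : 'cV[R]_n) : 'cV[R]_n :=
  (M / Num.max M `|v|) *: v.

Section radial_retract.
Variable M : R.
Hypothesis M0 : 0 < M.

Let maxM v : 0 < Num.max M `|v|.
Proof. by rewrite lt_max M0. Qed.

Lemma radial_retract_id v : `|v| <= M -> radial_retract M v = v.
Proof. by move=> vM; rewrite /radial_retract max_l// divff ?gt_eqF// scale1r. Qed.

Lemma norm_radial_retract v : `|radial_retract M v| <= M.
Proof.
rewrite normrZ ger0_norm ?divr_ge0 ?(ltW M0) ?(ltW (maxM v))//.
by rewrite mulrAC ler_pdivrMr// ler_wpM2l ?(ltW M0)// le_max lexx orbT.
Qed.

Lemma radial_retract_lipschitz u v :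
  `|radial_retract M u - radial_retract M v| <= 2 * `|u - v|.
Proof.
pose a := Num.max M `|u|; pose b := Num.max M `|v|.
have a0 : 0 < a := maxM u.
have b0 : 0 < b := maxM v.
have ab : `|b - a| <= `|u - v|.
  have := ler_dist_dist u v; rewrite -/a -/b distrC /a /b.
  rewrite /Num.max !ler_norml => /andP[h1 h2].
  have h0 := normr_ge0 (u - v).
  by do ![case: ifPn]; rewrite -?leNgt => *; apply/andP; split; lra.
have -> : radial_retract M u - radial_retract M v =
    (M / a) *: (u - v) + (M / a * ((b - a) / b)) *: v.
  rewrite scalerBr /radial_retract -/a -/b -addrA; congr (_ + _).
  rewrite addrC -scalerBl -scaleNr; congr (_ *: _).
  by field; rewrite !gt_eqF.
have Ma : M / a <= 1 by rewrite ler_pdivrMr// mul1r le_max lexx.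
have Ma0 : 0 <= M / a by rewrite divr_ge0 ?ltW.
have vb : `|v| / b <= 1 by rewrite ler_pdivrMr// mul1r le_max lexx orbT.
have vb0 : 0 <= `|v| / b by rewrite divr_ge0// ltW.
rewrite mulr_natl mulr2n; apply: (le_trans (ler_normD _ _)); apply: lerD; rewrite normrZ.
  by rewrite (ger0_norm Ma0) ler_piMl.
rewrite normrM (ger0_norm Ma0) normrM (gtr0_norm (_ : 0 < b^-1)) ?invr_gt0//.
have -> : M / a * (`|b - a| / b) * `|v| = M / a * (`|v| / b) * `|b - a| by ring.
by apply: le_trans ab; rewrite ler_piMl// mulr_ile1.
Qed.

End radial_retract.

(** Truncating F as F (r v), with r v = rho v and 0 < rho <= 1, keeps the energy
    inequality: the rate of the truncation at v is 1 / rho times that of F at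
    rho v, and energy (rho v) = rho^2 energy v. *)
Lemma exists_volterra_energy F C : locally_lipschitz F -> 0 <= C ->
  (forall v, energy_rate F v <= C * energy v) ->
  exists2 x : R -> 'cV[R]_n, continuous x & volterra q G x0 T F x.
Proof.
move=> lF C0 FC; have [K Kbound] := a_priori_bound C0.
(* The 1 makes M at least its own square root, so that v_i^2 <= K / w i gives
   |v_i| <= M. *)
pose M : R := 1 + \sum_i `|K / w i|.
have M1 : 1 <= M by rewrite lerDl sumr_ge0.
have M0 : 0 < M by rewrite (lt_le_trans ltr01).
pose FM v := F (radial_retract M v).
have [L L0 FL] := lF _ (ltW M0).
have FMlip u v : `|FM u - FM v| <= L * 2 * `|u - v|.
  apply: (le_trans (FL _ _ (norm_radial_retract M0 _) (norm_radial_retract M0 _))).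
  by rewrite -mulrA ler_wpM2l// radial_retract_lipschitz.
have FMB v : `|FM v| <= `|F 0| + L * M.
  rewrite -[FM v](subrK (F 0)) addrC (le_trans (ler_normD _ _))// lerD2l.
  apply: (le_trans (FL _ _ (norm_radial_retract M0 _) _)); first by rewrite normr0 ltW.
  by rewrite subr0 ler_wpM2l// norm_radial_retract.
have L20 : 0 <= L * 2 by rewrite mulr_ge0.
have [x cx vx] := exists_volterra_lipschitz x0 q0 q1 G0 T0 L20 FMlip FMB.
exists x => // t tT.
have lFM : locally_lipschitz FM by move=> ? _; exists (L * 2).
have FMC v : energy_rate FM v <= C * energy v.
  pose r := M / Num.max M `|v|.
  have m0 : 0 < Num.max M `|v| by rewrite lt_max M0.
  have r0 : 0 < r by rewrite divr_gt0.
  have r1 : r <= 1 by rewrite ler_pdivrMr// mul1r le_max lexx.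
  have rateE : energy_rate F (radial_retract M v) = r * energy_rate FM v.
    rewrite /energy_rate mulr_sumr; apply: eq_bigr => i _.
    by rewrite mxE -/r /FM; ring.
  have energyE : energy (radial_retract M v) = r * (r * energy v).
    by rewrite /energy !mulr_sumr; apply: eq_bigr => i _; rewrite mxE -/r; ring.
  have := FC (radial_retract M v); rewrite rateE energyE mulrCA ler_pM2l//.
  by move=> /le_trans; apply; rewrite ler_wpM2l// ler_piMl// energy_ge0.
have EK := Kbound FM x lFM cx FMC vx.
have FE s : 0 <= s <= T -> FM (x s) = F (x s).
  move=> sT; rewrite /FM radial_retract_id//.
  apply: norm_le_coord => [|i]; first exact: ltW.
  have h : x s i 0 ^+ 2 <= M - 1.
    apply: (le_trans (sqr_coord_le_energy _ _)).
    apply: (@le_trans _ _ (K / w i)).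
      by rewrite ler_wpM2r ?invr_ge0 ?(ltW (w0 i))// EK.
    rewrite /M addrAC subrr add0r (bigD1 i)//= (le_trans (ler_norm _))// lerDl.
    exact: sumr_ge0.
  rewrite -ler_sqr ?nnegrE ?(ltW M0)// real_normK ?num_real//.
  apply: (le_trans h).
  by rewrite expr2 (@le_trans _ _ M) ?gerBl// ler_peMr// ltW.
rewrite vx// /volterra_op; congr (_ + _); apply/colP => i; rewrite !mxE.
congr (_ * _); apply: eq_Rintegral => s; rewrite inE/= in_itv/= => /andP[s0 st].
by rewrite FE// s0 ltW// (lt_le_trans st)//; case/andP: tT.
Qed.

End energy.

(** * The Caputo problem and the Chen-Lee system *)

(** Makes 1 / Gamma(q) a possible value of the factor G of the previous parts. *)
Lemma Gamma_ge0 (R : realType) (z : R) : 0 <= Gamma z.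
Proof. by apply: Rintegral_ge0 => s _; rewrite mulr_ge0 ?powR_ge0 ?expR_ge0. Qed.

Lemma frac_integralE (R : realType) (q t : R) (g : R -> R) : 0 < q -> 0 <= t ->
  continuous g -> frac_integral q g t = (Gamma q)^-1 * RL q g t.
Proof.
move=> q0 t0 cg; congr (_ * _); rewrite /RL /kint Rintegral_itv_bndo_bndc//.
exact: integrable_kernelM.
Qed.

Section caputo.
Variables (R : realType) (n : nat) (q : R) (F : 'cV[R]_n -> 'cV[R]_n).
Variables (x0 : 'cV[R]_n) (T : R).
Hypotheses (q0 : 0 < q) (lF : locally_lipschitz F).

Lemma volterra_caputo x : continuous x -> volterra q (Gamma q)^-1 x0 T F x ->
  caputo_ivp_solution q F x0 T x.
Proof.
move=> cx vx; split; first exact: continuous_subspaceT.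
move=> t /[dup] tT /andP[t0 _]; rewrite vx//; congr (_ + _).
apply/colP => i; rewrite !mxE frac_integralE//.
exact/continuous_coord/continuous_lipschitz_comp.
Qed.

Lemma caputo_volterra y : 0 <= T -> caputo_ivp_solution q F x0 T y ->
  continuous (fun t => y (clamp T t)) /\
  volterra q (Gamma q)^-1 x0 T F (fun t => y (clamp T t)).
Proof.
move=> T0 [cy vy].
have cyc : continuous (fun t => y (clamp T t)) by exact: continuous_comp_clamp.
split=> // t /[dup] tT /andP[t0 t1]; rewrite clamp_id// vy//; congr (_ + _).
apply/colP => i; rewrite !mxE -frac_integralE//; last first.
  apply: (@continuous_coord _ _ (fun s => F (y (clamp T s)))).
  exact: continuous_lipschitz_comp.
congr (_ * _); apply: eq_Rintegral => s; rewrite inE/= in_itv/= => /andP[s0 st].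
by rewrite clamp_id// s0 (le_trans st).
Qed.

Lemma caputo_wellposed (w : 'I_n -> R) (C : R) : q <= 1 -> 0 <= T ->
  (forall i, 0 < w i) -> 0 <= C ->
  (forall v, energy_rate w F v <= C * energy w v) ->
  exists x, caputo_ivp_solution q F x0 T x /\
    forall y, caputo_ivp_solution q F x0 T y ->
      forall t, 0 <= t <= T -> y t = x t.
Proof.
move=> q1 T0 w0 C0 FC.
have G0 : 0 <= (Gamma q)^-1 by rewrite invr_ge0 Gamma_ge0.
have [x cx vx] := exists_volterra_energy x0 q0 q1 G0 T0 w0 lF C0 FC.
exists x; split; first exact: volterra_caputo.
move=> y /(caputo_volterra T0)[cy vy] t tT.
rewrite -(volterra_unique q0 q1 G0 T0 lF cy cx vy vx tT).
by rewrite clamp_id.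
Qed.

End caputo.

Lemma ler_distM (R : realType) (M d x y x' y' : R) : `|x| <= M -> `|y'| <= M ->
  `|x - x'| <= d -> `|y - y'| <= d -> `|x * y - x' * y'| <= 2 * M * d.
Proof.
move=> xM yM dx dy.
have -> : x * y - x' * y' = x * (y - y') + (x - x') * y' by ring.
apply: (le_trans (ler_normD _ _)); rewrite !normrM.
have -> : 2 * M * d = M * d + d * M by ring.
by apply: lerD; apply: ler_pM.
Qed.

Lemma chen_lee_locally_lipschitz (R : realType) (a c : R) :
  locally_lipschitz (chen_lee a c).
Proof.
move=> M M0; exists (2 * M + `|a| + `|c|) => [|x y xM yM].
  by rewrite !addr_ge0 ?mulr_ge0.
have d0 := normr_ge0 (x - y).
have xi i : `|x i 0| <= M by rewrite (le_trans (coord_le_norm _ _)).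
have yi i : `|y i 0| <= M by rewrite (le_trans (coord_le_norm _ _)).
have di i : `|x i 0 - y i 0| <= `|x - y|.
  by have := coord_le_norm (x - y) i; rewrite !mxE.
have dM i j : `|x i 0 * x j 0 - y i 0 * y j 0| <= 2 * M * `|x - y|.
  exact: ler_distM.
have dZ (k : R) i : `|k * x i 0 - k * y i 0| <= `|k| * `|x - y|.
  by rewrite -mulrBr normrM ler_wpM2l.
apply: norm_le_coord => [|i]; first by rewrite mulr_ge0// !addr_ge0 ?mulr_ge0.
have a0 : 0 <= `|a| * `|x - y| by rewrite mulr_ge0.
have c0 : 0 <= `|c| * `|x - y| by rewrite mulr_ge0.
have m0 : 0 <= 2 * M * `|x - y| by rewrite !mulr_ge0.
rewrite !mxE !mulrDl; case: i => -[|[|[|//]]] i3 /=.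
- rewrite opprD addrACA -opprD.
  apply: (le_trans (ler_normD _ _)).
  have := dM (Ordinal (isT : (1 < 3)%N)) (Ordinal (isT : (2 < 3)%N)).
  have := dZ a (Ordinal (isT : (0 < 3)%N)).
  by rewrite normrN; lra.
- have := dM (Ordinal (isT : (0 < 3)%N)) (Ordinal (isT : (2 < 3)%N)).
  lra.
- rewrite opprD addrACA -opprD.
  apply: (le_trans (ler_normD _ _)); rewrite normrN -!mulrA -mulrBr normrM.
  rewrite (ger0_norm (_ : 0 <= 3^-1 :> R)) ?invr_ge0//.
  have := dM (Ordinal (isT : (0 < 3)%N)) (Ordinal (isT : (1 < 3)%N)).
  have := dZ c (Ordinal (isT : (2 < 3)%N)).
  lra.
Qed.

(** The weights solve - w1 + w2 + w3 / 3 = 0, the condition for the products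
    x1 x2 x3 to cancel. *)
Definition chen_lee_weight (R : realType) (i : 'I_3) : R := [:: 2; 1; 3]`_i.

Lemma chen_lee_energy_rate_le (R : realType) (a c : R) v :
  energy_rate (@chen_lee_weight R) (chen_lee a c) v <=
  (`|a| + `|c|) * energy (@chen_lee_weight R) v.
Proof.
pose i1 := @Ordinal 3 0 isT; pose i2 := @Ordinal 3 1 isT; pose i3 := @Ordinal 3 2 isT.
have sum3 (f : 'I_3 -> R) : \sum_i f i = f i1 + f i2 + f i3.
  rewrite !big_ord_recr big_ord0 /= add0r.
  by congr (f _ + f _ + f _); apply/val_inj.
rewrite /energy_rate /energy !sum3 /chen_lee_weight !mxE /=.
move: (v i1 0) (v i2 0) (v i3 0) => x y z.
rewrite [leLHS](_ : _ = 2 * (a * x ^+ 2) + 3 * (- c * z ^+ 2)); last by field.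
have ax : a * x ^+ 2 <= `|a| * x ^+ 2 by rewrite ler_wpM2r ?sqr_ge0// ler_norm.
have cz : - c * z ^+ 2 <= `|c| * z ^+ 2.
  by rewrite ler_wpM2r ?sqr_ge0// -normrN ler_norm.
have nn (k r : R) : 0 <= `|k| * r ^+ 2 by rewrite mulr_ge0 ?sqr_ge0.
have := nn a y; have := nn a z; have := nn c x; have := nn c y.
by move: ax cz; lra.
Qed.

Theorem theorem2 (R : realType) (q a c T : R) (x0 : 'cV[R]_3)
    (hq : 0 < q < 1) (hac : a * c != 0) (hT : 0 < T) :
  exists x : R -> 'cV[R]_3,
    caputo_ivp_solution q (chen_lee a c) x0 T x /\
    forall y : R -> 'cV[R]_3, caputo_ivp_solution q (chen_lee a c) x0 T y ->
      forall t : R, 0 <= t <= T -> y t = x t.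
Proof.
case/andP: hq => q0 q1.
apply: (@caputo_wellposed _ _ _ _ _ _ _ _ (@chen_lee_weight R) (`|a| + `|c|)) => //.
- exact: chen_lee_locally_lipschitz.
- exact: ltW.
- exact: ltW.
- by case=> -[|[|[|//]]] i3; rewrite /chen_lee_weight /=.
- exact: chen_lee_energy_rate_le.
Qed.
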